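(* If $\nu\geq 0$, then the function $x\mapsto I_{\nu}(x)K_{\nu}(x)+\ln x$ is increasing on $(0,\infty)$. Consequently, if $\nu\geq 0$ and $x\in(0,1]$, then $$I_{\nu}(x)K_{\nu}(x)+\ln x\leq I_{\nu}(1)K_{\nu}(1).$$ Moreover, in particular, for all $x\in(0,1]$, $$\ln 2-\gamma<I_0(x)K_0(x)+\ln x\leq I_0(1)K_0(1),$$ where the constants $\ln 2-\gamma$ and $I_0(1)K_0(1)\simeq 0.533045\ldots$ are the best possible (that is, on $(0,1]$ the lower constant cannot be replaced by a larger one and the upper constant cannot be replaced by a smaller one).
   Context: $I_\nu$ and $K_\nu$ denote the modified Bessel functions of the first and second kind of order $\nu$, and $\gamma$ denotes the Euler–Mascheroni constant. *)

(* Defs.v *)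
From Stdlib Require Import Reals Factorial.
From Coquelicot Require Import Coquelicot.
Open Scope R_scope.

(* 1 / Gamma(z), by Gauss's product
   Gamma(z) = lim_n n! n^z / (z (z + 1) ... (z + n)).
   Taking the reciprocal makes it total on R, with value 0 at the poles
   0, -1, -2, ... of Gamma; prod_f_R0 _ n has n + 1 factors. *)
Definition rGamma (z : R) : R :=
  real (Lim_seq (fun n : nat =>
    prod_f_R0 (fun k : nat => z + INR k) n
      / (INR (fact n) * Rpower (INR n) z))).

(* I_nu(x) = sum_n (x/2)^(2n + nu) / (n! Gamma(n + nu + 1)), for real nu and
   x > 0 (Rpower is the real power only for a positive base). *)
Definition bessel_I (nu x : R) : R :=
  Series (fun n : nat =>
    Rpower (x / 2) (2 * INR n + nu)
      * (rGamma (INR n + nu + 1) / INR (fact n))).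

Definition bessel_K_quotient (nu x : R) : R :=
  PI / 2 * ((bessel_I (- nu) x - bessel_I nu x) / sin (nu * PI)).

(* sin (nu * PI) = 0 exactly when nu is an integer; K_nu is then the limit of
   K_mu as mu tends to nu. *)
Definition bessel_K (nu x : R) : R :=
  if Req_dec_T (sin (nu * PI)) 0
  then real (Lim (fun mu : R => bessel_K_quotient mu x) nu)
  else bessel_K_quotient nu x.

(* lim_n (1 + 1/2 + ... + 1/(n + 1) - ln (n + 1)); sum_f_R0 _ n has n + 1
   terms. *)
Definition euler_gamma : R :=
  real (Lim_seq (fun n : nat =>
    sum_f_R0 (fun k : nat => / INR (S k)) n - ln (INR (S n)))).

(* Main.v *)
Require Import Defs.
From Stdlib Require Import Reals ZArith Factorial Lra Lia Psatz.
From Coquelicot Require Import Coquelicot.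
Open Scope R_scope.

(* The Wronskian I' K - I K' = 1/x gives (I K + ln)' = 2 I' K, so the claim
   reduces to K > 0. For non-integer order, K/I is decreasing because its
   derivative is -1/(x I^2), and on 0 < nu < 1 it cannot become negative since
   I_{-nu}/I_nu has lower limit at least 1 at infinity; the recurrence
   K_{nu+1} = K_{nu-1} + (2 nu/x) K_nu carries positivity to all nu > 0. The
   Wronskian itself comes down to Euler's reflection formula, obtained from the
   integrals of cos^(2m) t cos(2 nu t). At an integer n the limit defining K_n
   exists for n = 0 by differentiating I_nu in nu, which yields
   K_0(x) = sum_k H_k (x/2)^(2k)/(k!)^2 - (ln (x/2) + gamma) I_0(x), and then for
   all n by I_nu K_{nu+1} + I_{nu+1} K_nu = 1/x; a quantitative form of
   monotonicity, involving only I, survives this limit. The formula for K_0 gives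
   the constant ln 2 - gamma and the numerical value at 1. *)

(** The definition of [bessel_K] shows neither its sign nor, at integer order, that its limit
    exists: [Lim] and [real] return some value in any case. Everything is drawn from the power
    series. Splitting off (x/2)^nu leaves an entire function of z = (x/2)^2, so the constant of the
    Wronskian can be read off at z = 0, where it is a product of two reciprocal Gamma values; this
    is where the reflection formula enters. Positivity of K for 0 < nu < 1 needs information on I at
    infinity, and a comparison of I_mu with I_(mu+s) up to a factor 1 - O(1/x) is enough; it comes
    from log-convexity of Gamma applied to each coefficient. In the limit to an integer order strict
    inequalities become weak, so the increase is bounded below by a quantity whose limit is visibly
    positive. Derivatives in the order are taken only at 0, through explicit quadratic remainders,
    with no interchange of limit and sum. *)

(** * Elementary inequalities for powers, exp and ln *)

Lemma Rpower_le_affine (a s : R) :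
  0 < a -> 0 <= s <= 1 -> Rpower a s <= 1 + s * (a - 1).
Proof.
  intros Ha Hs. unfold Rpower.
  set (L := ln a).
  (* Convexity of s -> a^s: the tangent at s lies below the values a and 1 at the endpoints 1 and 0;
     with weights s and 1 - s the terms in ln a cancel. *)
  assert (E1 : a = exp (s * L) * exp ((1 - s) * L)).
  { rewrite <- exp_plus. replace (s * L + (1 - s) * L) with L by ring.
    unfold L. now rewrite exp_ln. }
  assert (E2 : 1 = exp (s * L) * exp (- (s * L))).
  { rewrite <- exp_plus. rewrite Rplus_opp_r. now rewrite exp_0. }
  pose proof (exp_ineq1_le ((1 - s) * L)) as H1.
  pose proof (exp_ineq1_le (- (s * L))) as H2.
  pose proof (exp_pos (s * L)) as H0.
  apply Rle_trans with (s * a + (1 - s) * 1); [|lra].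
  assert (H3 : exp (s * L) * (1 + (1 - s) * L) <= a)
    by (rewrite E1; apply Rmult_le_compat_l; lra).
  assert (H4 : exp (s * L) * (1 + - (s * L)) <= 1)
    by (rewrite E2; apply Rmult_le_compat_l; lra).
  apply (Rmult_le_compat_l s) in H3; [|lra].
  apply (Rmult_le_compat_l (1 - s)) in H4; lra.
Qed.

Lemma ln_le_sub1 (a : R) : 0 < a -> ln a <= a - 1.
Proof.
  intros Ha. pose proof (exp_ineq1_le (ln a)). rewrite exp_ln in H; lra.
Qed.

Lemma Rpower_pos (a s : R) : 0 < Rpower a s.
Proof. apply exp_pos. Qed.

Lemma exp_le (a b : R) : a <= b -> exp a <= exp b.
Proof.
  intros [H|H]; [left; now apply exp_increasing | right; now rewrite H].
Qed.

Lemma INR_fact_pos (n : nat) : 0 < INR (fact n).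
Proof. apply lt_0_INR, lt_O_fact. Qed.

Lemma INR_fact_S (n : nat) : INR (fact (S n)) = (INR n + 1) * INR (fact n).
Proof. rewrite <- S_INR, <- mult_INR. reflexivity. Qed.

(** * The reciprocal Gamma function *)

(** At n = 0 the power has base 0 and is only a default value, so the finite identities below are
    stated at [S n]. *)
Definition gauss_seq (z : R) (n : nat) : R :=
  prod_f_R0 (fun k : nat => z + INR k) n / (INR (fact n) * Rpower (INR n) z).

Lemma gauss_prod_S (z : R) (n : nat) :
  prod_f_R0 (fun k : nat => z + INR k) (S n)
  = prod_f_R0 (fun k : nat => z + INR k) n * (z + INR (S n)).
Proof. reflexivity. Qed.

Lemma gauss_prod_pos (z : R) (n : nat) :
  0 < z -> 0 < prod_f_R0 (fun k : nat => z + INR k) n.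
Proof.
  intros Hz. induction n as [|n IH].
  - simpl; lra.
  - rewrite gauss_prod_S. apply Rmult_lt_0_compat; [exact IH|]. pose proof (pos_INR (S n)). lra.
Qed.

Lemma gauss_seq_pos (z : R) (n : nat) : 0 < z -> 0 < gauss_seq z n.
Proof.
  intros Hz. apply Rdiv_lt_0_compat.
  - now apply gauss_prod_pos.
  - apply Rmult_lt_0_compat; [apply INR_fact_pos | apply Rpower_pos].
Qed.

Lemma gauss_prod_shift (z : R) (n : nat) :
  prod_f_R0 (fun k : nat => z + INR k) n * (z + INR n + 1)
  = z * prod_f_R0 (fun k : nat => z + 1 + INR k) n.
Proof.
  induction n as [|n IH].
  - simpl; ring.
  - rewrite !gauss_prod_S.
    replace (prod_f_R0 (fun k : nat => z + INR k) n * (z + INR (S n)) * (z + INR (S n) + 1))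
      with (prod_f_R0 (fun k : nat => z + INR k) n * (z + INR n + 1) * (z + INR (S n) + 1))
      by (rewrite S_INR; ring).
    rewrite IH. ring.
Qed.

Lemma gauss_seq_shift (z : R) (n : nat) :
  gauss_seq z (S n) * (1 + (z + 1) / INR (S n)) = z * gauss_seq (z + 1) (S n).
Proof.
  unfold gauss_seq.
  pose proof (INR_fact_pos (S n)) as Hf.
  assert (Hn : 0 < INR (S n)) by (apply lt_0_INR; lia).
  pose proof (Rpower_pos (INR (S n)) z) as Hp.
  rewrite Rpower_plus, Rpower_1 by exact Hn.
  pose proof (gauss_prod_shift z (S n)) as E.
  set (A := prod_f_R0 (fun k : nat => z + INR k) (S n)) in *.
  set (B := prod_f_R0 (fun k : nat => z + 1 + INR k) (S n)) in *.
  replace (z * (B / (INR (fact (S n)) * (Rpower (INR (S n)) z * INR (S n)))))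
    with ((z * B) / (INR (fact (S n)) * (Rpower (INR (S n)) z * INR (S n))))
    by (field; repeat split; lra).
  rewrite <- E. field. repeat split; lra.
Qed.

(** With m = n + 1, the quotient of the two terms is (1 + z/(m+1)) / (1 + 1/m)^z. Both parts are
    compared with exp (z/(m+1)), using ln (1 + 1/m) >= 1/(m+1). *)
Lemma gauss_seq_decr (z : R) (n : nat) :
  0 < z -> gauss_seq z (S (S n)) <= gauss_seq z (S n).
Proof.
  intros Hz. unfold gauss_seq.
  set (m := S n).
  assert (Hm : 0 < INR m) by (apply lt_0_INR; unfold m; lia).
  pose proof (gauss_prod_pos z m Hz) as HP.
  pose proof (INR_fact_pos m) as Hf.
  rewrite INR_fact_S. rewrite !gauss_prod_S. rewrite S_INR.
  set (A := prod_f_R0 (fun k : nat => z + INR k) m) in *.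
  replace (INR m + 1) with (INR m * (1 + / INR m)) at 3 by (field; lra).
  assert (Hi : 0 < / INR m) by now apply Rinv_0_lt_compat.
  pose proof (Rpower_pos (INR m) z) as Hp.
  assert (Hq : 1 + z / (INR m + 1) <= Rpower (1 + / INR m) z).
  { apply Rle_trans with (exp (z / (INR m + 1))); [apply exp_ineq1_le|].
    unfold Rpower. apply exp_le.
    { apply Rmult_le_compat_l; [lra|].
      pose proof (ln_le_sub1 (/ (1 + / INR m))) as H.
      rewrite ln_Rinv in H by lra.
      assert (/ (1 + / INR m) = 1 - / (INR m + 1)) as E by (field; lra).
      assert (0 < / (1 + / INR m)) by (apply Rinv_0_lt_compat; lra).
      specialize (H H0). rewrite E in H. lra. } }
  rewrite <- Rpower_mult_distr by lra.
  set (q := Rpower (1 + / INR m) z) in *.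
  set (p := Rpower (INR m) z) in *.
  assert (Hq0 : 0 < q) by apply Rpower_pos.
  apply Rle_div_l; [repeat apply Rmult_lt_0_compat; lra|].
  replace (A / (INR (fact m) * p) * ((INR m + 1) * INR (fact m) * (p * q)))
    with (A * ((INR m + 1) * q)) by (field; lra).
  apply Rmult_le_compat_l; [lra|].
  apply Rle_trans with ((INR m + 1) * (1 + z / (INR m + 1))).
  - right; field; lra.
  - apply Rmult_le_compat_l; lra.
Qed.

Lemma gauss_seq_cvg_pos (z : R) : 0 < z -> ex_finite_lim_seq (gauss_seq z).
Proof.
  intros Hz.
  destruct (ex_finite_lim_seq_decr (fun n => gauss_seq z (S n)) 0) as [l Hl].
  - intros n. now apply gauss_seq_decr.
  - intros n. left. now apply gauss_seq_pos.
  - exists l. now apply is_lim_seq_incr_1.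
Qed.

Lemma is_lim_seq_inv_S : is_lim_seq (fun n : nat => / INR (S n)) 0.
Proof.
  apply (is_lim_seq_incr_1 (fun n => / INR n)).
  replace (Finite 0) with (Rbar_inv p_infty) by reflexivity.
  apply is_lim_seq_inv; [apply is_lim_seq_INR | discriminate].
Qed.

Lemma is_lim_seq_one_plus_div (c : R) :
  is_lim_seq (fun n : nat => 1 + c / INR (S n)) 1.
Proof.
  replace (Finite 1) with (Finite (1 + c * 0)) by (f_equal; ring).
  apply is_lim_seq_plus'; [apply is_lim_seq_const|].
  apply is_lim_seq_mult'; [apply is_lim_seq_const|].
  exact is_lim_seq_inv_S.
Qed.

Lemma gauss_seq_lim_shift (z l : R) :
  is_lim_seq (gauss_seq (z + 1)) l -> is_lim_seq (gauss_seq z) (z * l).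
Proof.
  intros Hl. apply is_lim_seq_incr_1 in Hl. apply is_lim_seq_incr_1.
  replace (Finite (z * l)) with (Finite (z * l / 1)) by (f_equal; field).
  apply is_lim_seq_ext_loc
    with (fun n : nat => z * gauss_seq (z + 1) (S n) / (1 + (z + 1) / INR (S n))).
  - assert (H1 := is_lim_seq_one_plus_div (z + 1)).
    apply is_lim_seq_spec in H1.
    destruct (H1 (mkposreal _ Rlt_0_1)) as [N HN]. exists N. intros n Hn.
    specialize (HN n Hn). simpl pos in HN. apply Rabs_def2 in HN.
    assert (Hm : 0 < INR (S n)) by (apply lt_0_INR; lia).
    assert (0 < INR (S n) * (1 + (z + 1) / INR (S n)))
      by (apply Rmult_lt_0_compat; lra).
    replace (INR (S n) * (1 + (z + 1) / INR (S n))) with (INR (S n) + (z + 1)) in *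
      by (field; lra).
    rewrite <- gauss_seq_shift. field. lra.
  - apply is_lim_seq_div'; [|apply is_lim_seq_one_plus_div|lra].
    apply is_lim_seq_mult'; [apply is_lim_seq_const|exact Hl].
Qed.

(** Monotonicity settles z > 0 only; the functional equation carries convergence to the left one
    unit at a time, and at a pole of Gamma the factor z produces the limit 0. *)
Lemma gauss_seq_cvg (z : R) : ex_finite_lim_seq (gauss_seq z).
Proof.
  assert (H : forall (n : nat) (w : R), 0 < w + INR n -> ex_finite_lim_seq (gauss_seq w)).
  { intros n. induction n as [|n IH]; intros w Hw.
    - apply gauss_seq_cvg_pos. simpl in Hw; lra.
    - rewrite S_INR in Hw. destruct (IH (w + 1)) as [l Hl]; [lra|].
      exists (w * l). now apply gauss_seq_lim_shift. }
  destruct (INR_unbounded (- z)) as [n Hn].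
  apply (H n). lra.
Qed.

Lemma is_lim_gauss_seq (z : R) : is_lim_seq (gauss_seq z) (rGamma z).
Proof. exact (Lim_seq_correct' _ (gauss_seq_cvg z)). Qed.

Lemma rGamma_shift (z : R) : rGamma z = z * rGamma (z + 1).
Proof.
  assert (H := is_lim_seq_unique _ _ (gauss_seq_lim_shift z _ (is_lim_gauss_seq (z + 1)))).
  rewrite (is_lim_seq_unique _ _ (is_lim_gauss_seq z)) in H. now injection H.
Qed.

Lemma rGamma_1 : rGamma 1 = 1.
Proof.
  assert (H : is_lim_seq (gauss_seq 1) 1).
  { apply is_lim_seq_incr_1.
    apply is_lim_seq_ext with (fun n : nat => 1 + 1 / INR (S n));
      [|apply is_lim_seq_one_plus_div].
    intros n. unfold gauss_seq.
    assert (Hn : 0 < INR (S n)) by (apply lt_0_INR; lia).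
    rewrite Rpower_1 by exact Hn.
    assert (E : forall m, prod_f_R0 (fun k : nat => 1 + INR k) m = INR (fact (S m))).
    { induction m as [|m IH]; [simpl; ring|].
      rewrite !gauss_prod_S. rewrite IH, (INR_fact_S (S m)). ring. }
    rewrite E, (INR_fact_S (S n)). pose proof (INR_fact_pos (S n)).
    field. lra. }
  assert (H' := is_lim_seq_unique _ _ H).
  rewrite (is_lim_seq_unique _ _ (is_lim_gauss_seq 1)) in H'. now injection H'.
Qed.

(* Log-convexity of Gamma, in the form Gamma (y + s) <= Gamma y * y ^ s. *)
Lemma rGamma_add_ge (y s : R) :
  0 < y -> 0 <= s <= 1 -> rGamma y * Rpower (/ y) s <= rGamma (y + s).
Proof.
  intros Hy Hs.
  (* Each factor satisfies w ((w+1)/w)^s <= w + s by convexity, and the quotients (w+1)/w for w = y,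
     ..., y + n telescope to (y+n+1)/y. *)
  assert (Hprod : forall n : nat,
    prod_f_R0 (fun k : nat => y + INR k) n * Rpower ((y + INR n + 1) / y) s
    <= prod_f_R0 (fun k : nat => y + s + INR k) n).
  { assert (Hstep : forall w, 0 < w -> w * Rpower ((w + 1) / w) s <= w + s).
    { intros w Hw.
      assert (0 < (w + 1) / w) by (apply Rdiv_lt_0_compat; lra).
      apply Rle_trans with (w * (1 + s * ((w + 1) / w - 1))).
      - apply Rmult_le_compat_l; [lra|]. now apply Rpower_le_affine.
      - right; field; lra. }
    induction n as [|n IH].
    - simpl. specialize (Hstep y Hy). rewrite !Rplus_0_r. lra.
    - rewrite !gauss_prod_S.
      pose proof (pos_INR n) as Hn.
      replace ((y + INR (S n) + 1) / y)
        with ((y + INR n + 1) / y * ((y + INR (S n) + 1) / (y + INR (S n))))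
        by (rewrite S_INR; field; lra).
      rewrite S_INR in *.
      rewrite <- Rpower_mult_distr by (apply Rdiv_lt_0_compat; lra).
      specialize (Hstep (y + (INR n + 1))).
      set (A := prod_f_R0 (fun k : nat => y + INR k) n) in *.
      assert (0 < A) by now apply gauss_prod_pos.
      set (p := Rpower ((y + INR n + 1) / y) s) in *.
      set (q := Rpower ((y + (INR n + 1) + 1) / (y + (INR n + 1))) s) in *.
      assert (0 < p) by apply Rpower_pos. assert (0 < q) by apply Rpower_pos.
      replace (A * (y + (INR n + 1)) * (p * q))
        with ((A * p) * ((y + (INR n + 1)) * q)) by ring.
      apply Rmult_le_compat; try (apply Rmult_le_pos; lra); [exact IH|].
      lra. }
  assert (H : forall n : nat,
    Rpower (/ y) s * gauss_seq y (S n) <= gauss_seq (y + s) (S n)).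
  { intros n. unfold gauss_seq. specialize (Hprod (S n)).
    assert (Hn : 0 < INR (S n)) by (apply lt_0_INR; lia).
    set (m := INR (S n)) in *.
    (* The factor m^s is exactly what separates the normalisations m^y and m^(y+s) of the two Gauss
       sequences. *)
    assert (Hpow : Rpower (/ y) s * Rpower m s <= Rpower ((y + m + 1) / y) s).
    { rewrite Rpower_mult_distr; [|now apply Rinv_0_lt_compat|exact Hn].
      apply Rle_Rpower_l; [lra|]. split.
      - apply Rmult_lt_0_compat; [now apply Rinv_0_lt_compat|exact Hn].
      - unfold Rdiv. rewrite Rmult_comm. apply Rmult_le_compat_r; [|lra].
        left; now apply Rinv_0_lt_compat. }
    rewrite Rpower_plus.
    pose proof (INR_fact_pos (S n)) as Hf.
    pose proof (Rpower_pos m y). pose proof (Rpower_pos m s).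
    pose proof (gauss_prod_pos y (S n) Hy) as HA.
    assert (HD : 0 < INR (fact (S n)) * (Rpower m y * Rpower m s)).
    { apply Rmult_lt_0_compat; [exact Hf|]. now apply Rmult_lt_0_compat. }
    apply (proj1 (Rle_div_r _ _ _ HD)).
    eapply Rle_trans; [|exact Hprod].
    eapply Rle_trans; [|apply Rmult_le_compat_l; [left; exact HA | exact Hpow]].
    right. field. lra. }
  pose proof (is_lim_gauss_seq y) as L1. apply is_lim_seq_incr_1 in L1.
  pose proof (is_lim_gauss_seq (y + s)) as L2. apply is_lim_seq_incr_1 in L2.
  rewrite Rmult_comm.
  exact (is_lim_seq_le _ _ (Rpower (/ y) s * rGamma y) _ H
    (is_lim_seq_mult' _ _ _ _ (is_lim_seq_const _) L1) L2).
Qed.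

(** A decreasing sequence of positive terms could still tend to 0. The log-convexity bound based at
    [rGamma 1 = 1] excludes this on [1, 2], and the functional equation does the rest. *)
Lemma rGamma_pos (z : R) : 0 < z -> 0 < rGamma z.
Proof.
  assert (H1 : forall s, 0 <= s <= 1 -> 0 < rGamma (1 + s)).
  { intros s Hs. eapply Rlt_le_trans; [|apply rGamma_add_ge; lra].
    rewrite rGamma_1. apply Rmult_lt_0_compat; [lra|apply Rpower_pos]. }
  assert (H2 : forall (n : nat) w, 0 < w <= INR n + 1 -> 0 < rGamma w).
  { induction n as [|n IH]; intros w Hw.
    - simpl in Hw. rewrite rGamma_shift.
      apply Rmult_lt_0_compat; [lra|]. rewrite Rplus_comm. apply H1; lra.
    - rewrite S_INR in Hw. destruct (Rle_dec w 1) as [H|H].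
      + apply IH. pose proof (pos_INR n). lra.
      + assert (E := rGamma_shift (w - 1)). replace (w - 1 + 1) with w in E by ring.
        assert (0 < rGamma (w - 1)) by (apply IH; lra).
        rewrite E in H0. apply (Rmult_lt_reg_l (w - 1)); lra. }
  intros Hz. destruct (INR_unbounded z) as [n Hn]. apply (H2 n). lra.
Qed.

(** * The reflection formula *)

(** For a = 0 this is Wallis's integral. For even n and a = 2 nu, its recursion in n produces the
    factors of Euler's product for the sine. *)
Definition cos_integral (n : nat) (a : R) : R :=
  RInt (fun t => cos t ^ n * cos (a * t)) 0 (PI / 2).

Lemma ex_RInt_cos_integral (n : nat) (a : R) :
  ex_RInt (fun t => cos t ^ n * cos (a * t)) 0 (PI / 2).
Proof.
  apply (ex_RInt_continuous (V := R_CompleteNormedModule)). intros t _.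
  apply (ex_derive_continuous (K := R_AbsRing) (V := R_NormedModule)).
  auto_derive. trivial.
Qed.

Lemma is_RInt_cos_integral (n : nat) (a : R) :
  is_RInt (fun t => cos t ^ n * cos (a * t)) 0 (PI / 2) (cos_integral n a).
Proof. apply (RInt_correct (V := R_CompleteNormedModule)), ex_RInt_cos_integral. Qed.

(* Two integrations by parts, packaged as one explicit antiderivative. *)
Lemma cos_integral_rec (n : nat) (a : R) :
  ((INR n + 2) ^ 2 - a ^ 2) * cos_integral (S (S n)) a
  = (INR n + 2) * (INR n + 1) * cos_integral n a.
Proof.
  set (F := fun t => (INR n + 2) * cos t ^ (S n) * sin t * cos (a * t)
                     - a * cos t ^ (S (S n)) * sin (a * t)).
  set (dF := fun t =>
    ((INR n + 2) ^ 2 - a ^ 2) * (cos t ^ (S (S n)) * cos (a * t))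
    - (INR n + 2) * (INR n + 1) * (cos t ^ n * cos (a * t))).
  assert (H1 : is_RInt dF 0 (PI / 2) (F (PI / 2) - F 0)).
  { apply (is_RInt_derive (V := R_CompleteNormedModule) F dF).
    - intros t _. unfold F, dF. auto_derive; [trivial|].
      replace (INR (S n)) with (INR n + 1) by (now rewrite S_INR).
      replace (match n with O => 1 | S _ => INR n + 1 end) with (INR n + 1)
        by (destruct n; simpl; ring).
      simpl pow.
      assert (E : sin t * sin t = 1 - cos t * cos t)
        by (pose proof (sin2_cos2 t); unfold Rsqr in *; lra).
      transitivity ((INR n + 2) * cos (a * t) * cos t ^ n *
         (cos t * cos t - (INR n + 1) * (sin t * sin t))
        - a ^ 2 * cos t ^ n * cos t * cos t * cos (a * t)); [ring|].
      rewrite E. ring.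
    - intros t _. apply (ex_derive_continuous (K := R_AbsRing) (V := R_NormedModule)).
      unfold dF. auto_derive. trivial. }
  assert (H2 : is_RInt dF 0 (PI / 2)
    (((INR n + 2) ^ 2 - a ^ 2) * cos_integral (S (S n)) a
     - (INR n + 2) * (INR n + 1) * cos_integral n a)).
  { apply (is_RInt_minus (V := R_NormedModule));
      apply (is_RInt_scal (V := R_NormedModule)); apply is_RInt_cos_integral. }
  apply (is_RInt_unique (V := R_CompleteNormedModule)) in H1.
  apply (is_RInt_unique (V := R_CompleteNormedModule)) in H2.
  rewrite H1 in H2.
  assert (E : F (PI / 2) - F 0 = 0).
  { unfold F. rewrite (Rmult_0_r a), cos_PI2, sin_0. simpl. ring. }
  lra.
Qed.

Lemma cos_integral_0_0 : cos_integral 0 0 = PI / 2.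
Proof.
  unfold cos_integral.
  rewrite (RInt_ext (V := R_CompleteNormedModule) _ (fun _ => 1)).
  - rewrite RInt_const. unfold scal; simpl. unfold mult; simpl. ring.
  - intros t _. rewrite Rmult_0_l, cos_0. simpl. ring.
Qed.

Lemma cos_integral_0 (a : R) : a * cos_integral 0 a = sin (a * (PI / 2)).
Proof.
  assert (H : is_RInt (fun t => a * (cos t ^ 0 * cos (a * t))) 0 (PI / 2)
            (sin (a * (PI / 2)) - sin (a * 0))).
  { apply (is_RInt_derive (V := R_CompleteNormedModule) (fun t => sin (a * t))).
    - intros t _. auto_derive; [trivial|]. simpl. ring.
    - intros t _. apply (ex_derive_continuous (K := R_AbsRing) (V := R_NormedModule)).
      auto_derive. trivial. }
  pose proof (is_RInt_scal (V := R_NormedModule) _ _ _ a _ (is_RInt_cos_integral 0 a)) as H2.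
  apply (is_RInt_unique (V := R_CompleteNormedModule)) in H.
  apply (is_RInt_unique (V := R_CompleteNormedModule)) in H2.
  change (fun y => scal a (cos y ^ 0 * cos (a * y)))
    with (fun y => a * (cos y ^ 0 * cos (a * y))) in H2.
  rewrite H in H2. unfold scal in H2; simpl in H2; unfold mult in H2; simpl in H2.
  rewrite <- H2, Rmult_0_r, sin_0. ring.
Qed.

Lemma one_minus_cos_le (y : R) : 0 <= 1 - cos y <= y ^ 2 / 2.
Proof.
  split; [pose proof (COS_bound y); lra|].
  assert (E : cos y = 1 - 2 * sin (y / 2) * sin (y / 2))
    by (rewrite <- cos_2a_sin; f_equal; field).
  assert (Hs : (sin (y / 2)) ^ 2 <= (y / 2) ^ 2).
  { assert (H : forall u, 0 <= u -> - u <= sin u <= u).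
    { intros u Hu.
      destruct (Req_dec u 0) as [->|Hu0]; [rewrite sin_0; lra|].
      assert (Hp : 0 < u) by lra.
      destruct (Rle_dec u 1) as [H1|H1].
      - pose proof (sin_lt_x u Hp).
        assert (0 <= sin u) by (apply sin_ge_0; pose proof PI2_1; lra). lra.
      - pose proof (SIN_bound u). lra. }
    rewrite <- (pow2_abs (y / 2)).
    destruct (Rcase_abs (y / 2)) as [Hn|Hn].
    - rewrite Rabs_left by exact Hn. specialize (H (- (y / 2))).
      rewrite sin_neg in H. nra.
    - rewrite Rabs_right by exact Hn. specialize (H (y / 2)). nra. }
  rewrite E. nra.
Qed.

(** The inequality t <= tan t without a quotient: sin u - u cos u has derivative u sin u. It serves
    to absorb a weight t^2 into 1 - cos^2 t. *)
Lemma mul_cos_le_sin (t : R) : 0 <= t <= PI / 2 -> 0 <= t * cos t <= sin t.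
Proof.
  intros Ht. pose proof PI_RGT_0.
  split; [apply Rmult_le_pos; [lra|apply cos_ge_0; lra]|].
  destruct (Req_dec t 0) as [->|Ht0]; [rewrite sin_0; lra|].
  destruct (MVT_gen (fun u => sin u - u * cos u) 0 t (fun u => u * sin u)) as [c [Hc E]].
  - intros u _. auto_derive; [trivial|]. ring.
  - intros u _. apply derivable_continuous_pt. apply ex_derive_Reals_0. auto_derive. trivial.
  - rewrite Rmin_left, Rmax_right in Hc by lra.
    rewrite sin_0 in E.
    assert (0 <= c * sin c * (t - 0))
      by (repeat apply Rmult_le_pos; try lra; apply sin_ge_0; lra).
    lra.
Qed.

Lemma cos_integral_even_pos (m : nat) : 0 < cos_integral (2 * m) 0.
Proof.
  induction m as [|m IH].
  - simpl. rewrite cos_integral_0_0. pose proof PI_RGT_0; lra.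
  - replace (2 * S m)%nat with (S (S (2 * m))) by lia.
    pose proof (cos_integral_rec (2 * m) 0) as E.
    pose proof (pos_INR (2 * m)).
    apply (Rmult_lt_reg_l ((INR (2 * m) + 2) ^ 2 - 0 ^ 2)); [nra|].
    rewrite E, Rmult_0_r. repeat apply Rmult_lt_0_compat; lra.
Qed.

(** Since 1 - cos (a t) <= a^2 t^2 / 2 and (t cos t)^2 <= sin^2 t, the integrand of the difference
    is at most a^2/2 times cos^(2m) t - cos^(2m+2) t, whose integral the recursion evaluates. The
    denominator 2m + 1 makes the quotient of the integrals at a and at 0 tend to 1. *)
Lemma cos_integral_diff (m : nat) (a : R) :
  0 <= cos_integral (2 * S m) 0 - cos_integral (2 * S m) a
    <= a ^ 2 / 2 * (cos_integral (2 * S m) 0 / (2 * INR m + 1)).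
Proof.
  assert (Hrec : cos_integral (2 * m) 0 - cos_integral (2 * S m) 0
                 = cos_integral (2 * S m) 0 / (2 * INR m + 1)).
  { pose proof (cos_integral_rec (2 * m) 0) as E.
    replace (2 * S m)%nat with (S (S (2 * m))) by lia.
    rewrite mult_INR in E. simpl (INR 2) in E. pose proof (pos_INR m).
    assert (cos_integral (2 * m) 0 =
      (2 * INR m + 2) * cos_integral (S (S (2 * m))) 0 / (2 * INR m + 1)) as ->;
      [|field; lra].
    apply (Rmult_eq_reg_l ((2 * INR m + 2) * (2 * INR m + 1))); [|nra].
    transitivity ((1 + 1) * INR m * cos_integral (2*m) 0 * 0 +
        ((1 + 1) * INR m + 2) * ((1 + 1) * INR m + 1) * cos_integral (2 * m) 0); [ring|].
    rewrite <- E. field. lra. }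
  rewrite <- Hrec.
  assert (Hpt : forall t, 0 <= t <= PI / 2 ->
     0 <= cos t ^ (2 * S m) * cos (0 * t) - cos t ^ (2 * S m) * cos (a * t)
     <= a ^ 2 / 2 * (cos t ^ (2 * m) * cos (0 * t) - cos t ^ (2 * S m) * cos (0 * t))).
  { intros t Ht. rewrite Rmult_0_l, cos_0.
    replace (2 * S m)%nat with (S (S (2 * m))) by lia. rewrite <- !tech_pow_Rmult.
    assert (Hc : 0 <= cos t ^ (2 * m)) by (rewrite pow_mult; apply pow_le; nra).
    set (q := cos t ^ (2 * m)) in *.
    pose proof (one_minus_cos_le (a * t)) as [L U].
    pose proof (mul_cos_le_sin t Ht) as [L' U'].
    pose proof (sin2_cos2 t) as E. unfold Rsqr in E.
    replace (cos t * (cos t * q) * 1 - cos t * (cos t * q) * cos (a * t))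
      with (q * (cos t * cos t) * (1 - cos (a * t))) by ring.
    assert (0 <= q * (cos t * cos t)) by (apply Rmult_le_pos; [lra|nra]).
    split; [apply Rmult_le_pos; lra|].
    apply Rle_trans with (q * (cos t * cos t) * ((a * t) ^ 2 / 2));
      [apply Rmult_le_compat_l; lra|].
    replace (q * (cos t * cos t) * ((a * t) ^ 2 / 2))
      with (a ^ 2 / 2 * (q * ((t * cos t) * (t * cos t)))) by field.
    apply Rmult_le_compat_l; [nra|].
    replace (q * 1 - cos t * (cos t * q) * 1) with (q * (1 - cos t * cos t)) by ring.
    apply Rmult_le_compat_l; [lra|].
    replace (1 - cos t * cos t) with (sin t * sin t) by lra.
    apply Rmult_le_compat; lra. }
  pose proof PI_RGT_0.
  pose proof (is_RInt_cos_integral (2 * S m) 0) as R1.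
  pose proof (is_RInt_cos_integral (2 * S m) a) as R2.
  pose proof (is_RInt_cos_integral (2 * m) 0) as R3.
  pose proof (is_RInt_minus (V := R_NormedModule) _ _ _ _ _ _ R1 R2) as R4.
  pose proof (is_RInt_scal (V := R_NormedModule) _ _ _ (a ^ 2 / 2) _
               (is_RInt_minus (V := R_NormedModule) _ _ _ _ _ _ R3 R1)) as R5.
  split.
  - pose proof (is_RInt_const (V := R_NormedModule) 0 (PI / 2) 0) as R0.
    apply Rle_trans with (scal (V := R_NormedModule) (PI / 2 - 0) 0);
      [right; unfold scal; simpl; unfold mult; simpl; ring|].
    refine (is_RInt_le _ _ 0 (PI / 2) _ _ ltac:(lra) R0 R4 _).
    intros t Ht. apply Hpt. lra.
  - refine (is_RInt_le _ _ 0 (PI / 2) _ _ ltac:(lra) R4 R5 _).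
    intros t Ht. apply Hpt. lra.
Qed.

(** Partial product of sin (pi nu) / (pi nu), with m + 1 factors. *)
Definition euler_sine_prod (nu : R) (m : nat) : R :=
  prod_f_R0 (fun k : nat => 1 - (nu / INR (S k)) ^ 2) m.

Lemma euler_sine_prod_S (nu : R) (m : nat) :
  euler_sine_prod nu (S m) = euler_sine_prod nu m * (1 - (nu / INR (S (S m))) ^ 2).
Proof. reflexivity. Qed.

(** The recursions at a = 2 nu and at a = 0 differ only by the factor 1 - (nu/(m+1))^2, so the
    quotient of the two integrals telescopes. *)
Lemma euler_sine_prod_cos_integral (nu : R) (m : nat) :
  cos_integral (2 * S m) (2 * nu) * euler_sine_prod nu m * (PI / 2)
  = cos_integral 0 (2 * nu) * cos_integral (2 * S m) 0.
Proof.
  assert (Hrec : forall (m : nat) b,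
    (1 - (b / INR (S m)) ^ 2) * cos_integral (2 * S m) (2 * b)
    = (2 * INR m + 1) / (2 * INR m + 2) * cos_integral (2 * m) (2 * b)).
  { intros k b. pose proof (cos_integral_rec (2 * k) (2 * b)) as E.
    replace (2 * S k)%nat with (S (S (2 * k))) by lia.
    rewrite mult_INR in E. simpl (INR 2) in E. rewrite S_INR. pose proof (pos_INR k).
    apply (Rmult_eq_reg_l ((2 * INR k + 2) ^ 2)); [|nra].
    transitivity ((((1 + 1) * INR k + 2) ^ 2 - (2 * b) ^ 2) * cos_integral (S (S (2 * k))) (2 * b));
      [field; lra|]. rewrite E. field. lra. }
  assert (Hrec0 : forall m : nat, cos_integral (2 * S m) 0
    = (2 * INR m + 1) / (2 * INR m + 2) * cos_integral (2 * m) 0).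
  { intros k. pose proof (Hrec k 0) as E. rewrite Rmult_0_r in E. rewrite <- E.
    unfold Rdiv. ring. }
  induction m as [|m IH].
  - change (euler_sine_prod nu 0) with (1 - (nu / INR 1) ^ 2).
    rewrite Hrec0, (Rmult_comm (cos_integral (2 * 1) (2 * nu))), Hrec.
    simpl (2 * 0)%nat. rewrite cos_integral_0_0. ring.
  - rewrite euler_sine_prod_S.
    replace (cos_integral (2 * S (S m)) (2 * nu) *
       (euler_sine_prod nu m * (1 - (nu / INR (S (S m))) ^ 2)) * (PI / 2))
      with ((1 - (nu / INR (S (S m))) ^ 2) * cos_integral (2 * S (S m)) (2 * nu)
            * (euler_sine_prod nu m * (PI / 2))) by ring.
    rewrite Hrec, (Hrec0 (S m)).
    rewrite <- (Rmult_assoc (cos_integral 0 (2 * nu))).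
    rewrite (Rmult_comm (cos_integral 0 (2 * nu))).
    rewrite (Rmult_assoc _ (cos_integral 0 (2 * nu))), <- IH. ring.
Qed.

(** Factors pair up as (k+1+nu)(k+1-nu) = (k+1)^2 (1 - (nu/(k+1))^2), and the powers multiply to
    (n+1)^2; the last factor compares (n+2)! with (n+1)! (n+1). *)
Lemma gauss_seq_reflection (nu : R) (n : nat) :
  gauss_seq (1 + nu) (S n) * gauss_seq (1 - nu) (S n)
  = euler_sine_prod nu (S n) * (1 + 1 / INR (S n)) ^ 2.
Proof.
  assert (HP : forall m : nat,
    prod_f_R0 (fun k : nat => 1 + nu + INR k) m * prod_f_R0 (fun k : nat => 1 - nu + INR k) m
    = euler_sine_prod nu m * INR (fact (S m)) ^ 2).
  { induction m as [|m IH].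
    - unfold euler_sine_prod. simpl. field.
    - rewrite !gauss_prod_S, euler_sine_prod_S, (INR_fact_S (S m)).
      transitivity ((prod_f_R0 (fun k : nat => 1 + nu + INR k) m
         * prod_f_R0 (fun k : nat => 1 - nu + INR k) m)
         * ((1 + nu + INR (S m)) * (1 - nu + INR (S m)))); [ring|].
      rewrite IH, (S_INR (S m)). pose proof (pos_INR (S m)). field. lra. }
  unfold gauss_seq. specialize (HP (S n)).
  assert (Hn : 0 < INR (S n)) by (apply lt_0_INR; lia).
  pose proof (INR_fact_pos (S n)).
  unfold Rminus. rewrite !Rpower_plus, Rpower_Ropp, Rpower_1 by exact Hn.
  pose proof (Rpower_pos (INR (S n)) nu).
  rewrite (INR_fact_S (S n)) in HP. unfold Rminus in HP.
  set (A := prod_f_R0 (fun k : nat => 1 + nu + INR k) (S n)) in *.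
  set (B := prod_f_R0 (fun k : nat => 1 + - nu + INR k) (S n)) in *.
  transitivity ((A * B) / (INR (fact (S n)) ^ 2 * INR (S n) ^ 2)); [field; lra|].
  rewrite HP. field. lra.
Qed.

(** In the limit the finite identities give [cos_integral 0 (2 * nu)] = pi/2 / (Gamma (1+nu) Gamma
    (1-nu)), while 2 nu times this integral is sin (pi nu). The arguments nu + 1 and -nu are those
    of the Wronskian at z = 0. *)
Lemma rGamma_reflection (nu : R) :
  rGamma (nu + 1) * rGamma (- nu) = - sin (nu * PI) / PI.
Proof.
  pose proof PI_RGT_0 as HPI.
  assert (Lratio : is_lim_seq (fun m => cos_integral (2 * S m) (2 * nu)
                                        / cos_integral (2 * S m) 0) 1).
  { apply is_lim_seq_incr_1.
    apply is_lim_seq_le_le with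
      (fun m => 1 + (- (2 * nu ^ 2)) / INR (S m)) (fun _ => 1);
      [|apply is_lim_seq_one_plus_div|apply is_lim_seq_const].
    intros m. pose proof (cos_integral_diff (S m) (2 * nu)) as [H1 H2].
    pose proof (cos_integral_even_pos (S (S m))) as Hp.
    assert (Hm : 0 < INR (S m)) by (apply lt_0_INR; lia).
    set (p := cos_integral (2 * S (S m)) 0) in *.
    set (q := cos_integral (2 * S (S m)) (2 * nu)) in *.
    split.
    - apply (proj1 (Rle_div_r _ _ _ Hp)).
      assert ((2 * nu) ^ 2 / 2 * (p / (2 * INR (S m) + 1)) <= 2 * nu ^ 2 / INR (S m) * p).
      { replace ((2 * nu) ^ 2 / 2 * (p / (2 * INR (S m) + 1)))
          with ((2 * nu ^ 2 * p) * / (2 * INR (S m) + 1)) by (field; lra).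
        replace (2 * nu ^ 2 / INR (S m) * p) with ((2 * nu ^ 2 * p) * / INR (S m))
          by (field; lra).
        apply Rmult_le_compat_l; [apply Rmult_le_pos; nra|].
        apply Rinv_le_contravar; lra. }
      unfold Rdiv in *. lra.
    - apply (proj2 (Rle_div_l _ _ _ Hp)). lra. }
  assert (Lprod : is_lim_seq (euler_sine_prod nu) (rGamma (1 + nu) * rGamma (1 - nu))).
  { apply is_lim_seq_incr_1.
    apply is_lim_seq_ext with (fun n =>
      gauss_seq (1 + nu) (S n) * gauss_seq (1 - nu) (S n)
      / ((1 + 1 / INR (S n)) * (1 + 1 / INR (S n)))).
    - intros n. rewrite gauss_seq_reflection.
      assert (Hn : 0 < INR (S n)) by (apply lt_0_INR; lia).
      field. lra.
    - replace (Finite (rGamma (1 + nu) * rGamma (1 - nu)))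
        with (Finite (rGamma (1 + nu) * rGamma (1 - nu) / (1 * 1))) by (f_equal; field).
      apply is_lim_seq_div'; [| |lra];
        apply is_lim_seq_mult'; try apply is_lim_seq_one_plus_div;
        apply (is_lim_seq_incr_1 (gauss_seq _)); apply is_lim_gauss_seq. }
  assert (E : cos_integral 0 (2 * nu) = PI / 2 * (rGamma (1 + nu) * rGamma (1 - nu))).
  { pose proof (is_lim_seq_mult' _ _ _ _ Lratio Lprod) as L.
    apply (is_lim_seq_mult' (fun _ => PI / 2) _ (PI / 2)) in L; [|apply is_lim_seq_const].
    apply is_lim_seq_ext with (v := fun _ => cos_integral 0 (2 * nu)) in L.
    - apply is_lim_seq_unique in L. rewrite Lim_seq_const in L. injection L. lra.
    - intros m. pose proof (cos_integral_even_pos (S m)) as Hp.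
      pose proof (euler_sine_prod_cos_integral nu m) as E.
      transitivity ((cos_integral (2 * S m) (2 * nu) * euler_sine_prod nu m * (PI / 2))
                    / cos_integral (2 * S m) 0); [field; lra|].
      rewrite E. field. lra. }
  pose proof (cos_integral_0 (2 * nu)) as E0. rewrite E in E0.
  replace (2 * nu * (PI / 2)) with (nu * PI) in E0 by field.
  rewrite (rGamma_shift (- nu)).
  replace (- nu + 1) with (1 - nu) by ring. rewrite (Rplus_comm nu 1).
  rewrite <- E0. field. lra.
Qed.

(** * The power series of the Bessel functions *)

(** Once the argument is at least 1, the functional equation shows that 1/Gamma does not grow in
    absolute value under a unit step; only finitely many terms come before. *)
Lemma rGamma_shift_bounded (nu : R) :
  exists M : R, 0 <= M /\ forall n : nat, Rabs (rGamma (INR n + nu + 1)) <= M.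
Proof.
  assert (H0 : forall N : nat, exists M : R, 0 <= M /\
    forall n : nat, (n <= N)%nat -> Rabs (rGamma (INR n + nu + 1)) <= M).
  { induction N as [|N [M [HM IH]]].
    - exists (Rabs (rGamma (INR 0 + nu + 1))). split; [apply Rabs_pos|].
      intros n Hn. replace n with 0%nat by lia. lra.
    - exists (Rmax M (Rabs (rGamma (INR (S N) + nu + 1)))). split.
      + eapply Rle_trans; [exact HM|apply Rmax_l].
      + intros n Hn. destruct (Nat.eq_dec n (S N)) as [->|Hne]; [apply Rmax_r|].
        eapply Rle_trans; [apply IH; lia|apply Rmax_l]. }
  destruct (INR_unbounded (- nu)) as [N HN].
  destruct (H0 N) as [M [HM HB]]. exists M. split; [exact HM|].
  induction n as [|n IH]; [apply HB; lia|].
  destruct (Nat.le_gt_cases (S n) N) as [H|H]; [now apply HB|].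
  assert (INR N <= INR n) by (apply le_INR; lia).
  rewrite rGamma_shift, Rabs_mult in IH.
  replace (INR n + nu + 1 + 1) with (INR (S n) + nu + 1) in IH by (rewrite S_INR; ring).
  rewrite Rabs_right in IH by lra.
  pose proof (Rabs_pos (rGamma (INR (S n) + nu + 1))). nra.
Qed.

Definition bessel_coef (nu : R) (n : nat) : R :=
  rGamma (INR n + nu + 1) / INR (fact n).

(** The Bessel-Clifford function, entire in z: I_nu(x) = (x/2)^nu P_nu((x/2)^2), and differentiation
    in z raises the order by 1. *)
Definition bessel_P (nu z : R) : R := PSeries (bessel_coef nu) z.

Lemma CV_radius_div_fact (a : nat -> R) (M : R) :
  (forall n : nat, Rabs (a n) <= M / INR (fact n)) -> CV_radius a = p_infty.
Proof.
  intros Ha.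
  assert (HM : 0 <= M).
  { specialize (Ha 0%nat). pose proof (Rabs_pos (a 0%nat)). simpl in Ha. lra. }
  destruct (CV_radius_bounded a) as [Hub _].
  assert (H : forall r : R, 0 <= r -> Rbar_le r (CV_radius a)).
  { intros r Hr. apply Hub. exists (M * exp r). intros n.
    rewrite Rabs_mult, (Rabs_right (r ^ n)) by (apply Rle_ge, pow_le, Hr).
    pose proof (INR_fact_pos n) as Hf.
    apply Rle_trans with (M / INR (fact n) * r ^ n).
    - apply Rmult_le_compat_r; [now apply pow_le|apply Ha].
    - replace (M / INR (fact n) * r ^ n) with (M * (r ^ n / INR (fact n))) by (field; lra).
      apply Rmult_le_compat_l; [exact HM|].
      eapply Rle_trans; [|exact (exp_ge_taylor r n Hr)].
      destruct n as [|n]; [simpl; lra|].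
      rewrite tech5.
      assert (0 <= sum_f_R0 (fun k : nat => r ^ k / INR (fact k)) n); [|lra].
      apply cond_pos_sum. intros k.
      apply Rdiv_le_0_compat; [now apply pow_le|apply INR_fact_pos]. }
  destruct (CV_radius a) as [c| |] eqn:E; [|reflexivity|].
  - specialize (H (Rmax 0 (c + 1)) (Rmax_l _ _)). simpl in H.
    pose proof (Rmax_r 0 (c + 1)). lra.
  - specialize (H 0 (Rle_refl 0)). destruct H.
Qed.

Lemma bessel_coef_CV_radius (nu : R) : CV_radius (bessel_coef nu) = p_infty.
Proof.
  destruct (rGamma_shift_bounded nu) as [M [HM HB]].
  apply (CV_radius_div_fact _ M). intros n. unfold bessel_coef.
  pose proof (INR_fact_pos n).
  rewrite Rabs_div by lra. rewrite (Rabs_right (INR (fact n))) by lra.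
  apply Rmult_le_compat_r; [left; now apply Rinv_0_lt_compat|apply HB].
Qed.

Lemma ex_pseries_bessel (nu z : R) : ex_pseries (bessel_coef nu) z.
Proof. apply CV_radius_inside. rewrite bessel_coef_CV_radius. exact I. Qed.

Lemma ex_series_bessel (nu z : R) : ex_series (fun n => bessel_coef nu n * z ^ n).
Proof.
  apply ex_series_Rabs, CV_disk_inside. rewrite bessel_coef_CV_radius. exact I.
Qed.

Lemma bessel_coef_S (nu : R) (n : nat) :
  INR (S n) * bessel_coef nu (S n) = bessel_coef (nu + 1) n.
Proof.
  unfold bessel_coef. rewrite INR_fact_S, S_INR.
  replace (INR n + 1 + nu + 1) with (INR n + (nu + 1) + 1) by ring.
  pose proof (INR_fact_pos n). pose proof (pos_INR n). field. lra.
Qed.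

Lemma bessel_coef_shift (nu : R) (n : nat) :
  bessel_coef nu n = (INR n + nu + 1) * bessel_coef (nu + 1) n.
Proof.
  unfold bessel_coef. rewrite (rGamma_shift (INR n + nu + 1)).
  replace (INR n + nu + 1 + 1) with (INR n + (nu + 1) + 1) by ring.
  pose proof (INR_fact_pos n). field. lra.
Qed.

Lemma bessel_coef_pos (nu : R) (n : nat) : -1 < nu -> 0 < bessel_coef nu n.
Proof.
  intros Hnu. apply Rdiv_lt_0_compat; [|apply INR_fact_pos].
  apply rGamma_pos. pose proof (pos_INR n). lra.
Qed.

Lemma is_derive_bessel_P (nu z : R) :
  is_derive (bessel_P nu) z (bessel_P (nu + 1) z).
Proof.
  unfold bessel_P at 2.
  rewrite (PSeries_ext _ (PS_derive (bessel_coef nu))).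
  - apply is_derive_PSeries. rewrite bessel_coef_CV_radius. exact I.
  - intros n. unfold PS_derive. now rewrite bessel_coef_S.
Qed.

Lemma bessel_P_rec (nu z : R) :
  bessel_P nu z = z * bessel_P (nu + 1 + 1) z + (nu + 1) * bessel_P (nu + 1) z.
Proof.
  unfold bessel_P.
  rewrite <- PSeries_incr_1, <- PSeries_scal, <- PSeries_plus.
  - apply PSeries_ext. intros [|n].
    + change (bessel_coef nu 0 = 0 + (nu + 1) * bessel_coef (nu + 1) 0).
      rewrite bessel_coef_shift. simpl. ring.
    + change (bessel_coef nu (S n)
              = bessel_coef (nu + 1 + 1) n + (nu + 1) * bessel_coef (nu + 1) (S n)).
      rewrite bessel_coef_shift, <- (bessel_coef_S (nu + 1) n). ring.
  - apply ex_pseries_incr_1, ex_pseries_bessel.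
  - apply ex_pseries_scal; [apply Rmult_comm|apply ex_pseries_bessel].
Qed.

Lemma bessel_P_at_0 (nu : R) : bessel_P nu 0 = rGamma (nu + 1).
Proof.
  unfold bessel_P. rewrite PSeries_0. unfold bessel_coef. simpl.
  rewrite Rplus_0_l. field.
Qed.

Lemma bessel_P_pos (nu z : R) : -1 < nu -> 0 <= z -> 0 < bessel_P nu z.
Proof.
  intros Hnu Hz. unfold bessel_P, PSeries.
  rewrite Series_incr_1 by apply ex_series_bessel.
  assert (0 <= Series (fun k => bessel_coef nu (S k) * z ^ S k)).
  { apply Rle_trans with (Series (fun _ : nat => 0)).
    - right. symmetry. apply is_series_unique.
      apply is_series_Reals. intros e He. exists 0%nat. intros n _.
      rewrite sum_eq_R0 by trivial. unfold Rdist. rewrite Rminus_0_r, Rabs_R0. exact He.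
    - apply Series_le.
      + intros n. split; [lra|]. apply Rmult_le_pos; [left; now apply bessel_coef_pos|].
        now apply pow_le.
      + apply (ex_series_incr_1 (fun k => bessel_coef nu k * z ^ k)), ex_series_bessel. }
  pose proof (bessel_coef_pos nu 0 Hnu). rewrite pow_O, Rmult_1_r. lra.
Qed.

(** By P_nu' = P_(nu+1) and the three-term recurrence the left side has derivative 0, so it equals
    its value at z = 0, where the reflection formula applies. *)
Lemma bessel_P_wronskian (nu z : R) : 0 <= z ->
  bessel_P nu z * bessel_P (- nu - 1) z - z * bessel_P (nu + 1) z * bessel_P (- nu) z
  = - sin (nu * PI) / PI.
Proof.
  intros Hz.
  set (w := fun z => bessel_P nu z * bessel_P (- nu - 1) z
                     - z * bessel_P (nu + 1) z * bessel_P (- nu) z).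
  assert (H0 : w 0 = - sin (nu * PI) / PI).
  { unfold w. rewrite !bessel_P_at_0, <- rGamma_reflection.
    replace (- nu - 1 + 1) with (- nu) by ring. ring. }
  fold (w z). rewrite <- H0.
  destruct Hz as [Hz|<-]; [|reflexivity]. symmetry.
  apply (eq_is_derive w 0 z); [|exact Hz].
  intros t _. unfold w.
  pose proof (is_derive_bessel_P nu t) as D1.
  pose proof (is_derive_bessel_P (- nu - 1) t) as D2.
  pose proof (is_derive_bessel_P (nu + 1) t) as D3.
  pose proof (is_derive_bessel_P (- nu) t) as D4.
  replace (- nu - 1 + 1) with (- nu) in D2 by ring.
  assert (D : is_derive (fun z => bessel_P nu z * bessel_P (- nu - 1) z
                     - z * bessel_P (nu + 1) z * bessel_P (- nu) z) t
     ((bessel_P (nu + 1) t * bessel_P (- nu - 1) t + bessel_P nu t * bessel_P (- nu) t)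
      - ((1 * bessel_P (nu + 1) t + t * bessel_P (nu + 1 + 1) t) * bessel_P (- nu) t
         + t * bessel_P (nu + 1) t * bessel_P (- nu + 1) t))).
  { apply (is_derive_minus (V := R_NormedModule)).
    - apply (is_derive_mult (bessel_P nu)); try assumption. apply Rmult_comm.
    - apply (is_derive_mult (fun z => z * bessel_P (nu + 1) z)); try assumption;
        [|apply Rmult_comm].
      apply (is_derive_mult (fun z : R => z)); try assumption; [|apply Rmult_comm].
      apply (is_derive_id (K := R_AbsRing)). }
  pose proof (bessel_P_rec nu t) as R1.
  pose proof (bessel_P_rec (- nu - 1) t) as R2.
  replace (- nu - 1 + 1) with (- nu) in R2 by ring.
  match type of D with is_derive _ _ ?e => replace e with (zero : R) in D; [exact D|] end.
  rewrite R1, R2. change (zero : R) with 0. ring.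
Qed.

(** * Modified Bessel functions of the first kind *)

Lemma bessel_I_eq (nu x : R) : 0 < x ->
  bessel_I nu x = Rpower (x / 2) nu * bessel_P nu ((x / 2) ^ 2).
Proof.
  intros Hx. unfold bessel_I, bessel_P, PSeries.
  rewrite <- Series_scal_l. apply Series_ext. intros n.
  rewrite Rpower_plus.
  replace (2 * INR n) with (INR (2 * n)) by (rewrite mult_INR; reflexivity).
  rewrite Rpower_pow by lra. rewrite pow_mult. unfold bessel_coef. ring.
Qed.

Lemma bessel_I_pos (nu x : R) : -1 < nu -> 0 < x -> 0 < bessel_I nu x.
Proof.
  intros Hnu Hx. rewrite bessel_I_eq by exact Hx.
  apply Rmult_lt_0_compat; [apply Rpower_pos|].
  apply bessel_P_pos; [exact Hnu|apply pow2_ge_0].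
Qed.

Lemma bessel_I_rec (nu x : R) : 0 < x ->
  bessel_I nu x = bessel_I (nu + 1 + 1) x + 2 * (nu + 1) / x * bessel_I (nu + 1) x.
Proof.
  intros Hx. rewrite !bessel_I_eq by exact Hx.
  rewrite bessel_P_rec, !Rpower_plus, Rpower_1 by lra. field. lra.
Qed.

Definition dbessel_I (nu x : R) : R := bessel_I (nu + 1) x + nu / x * bessel_I nu x.

Lemma is_derive_bessel_I (nu x : R) : 0 < x ->
  is_derive (bessel_I nu) x (dbessel_I nu x).
Proof.
  intros Hx. unfold dbessel_I.
  apply is_derive_ext_loc with (fun t => Rpower (t / 2) nu * bessel_P nu ((t / 2) ^ 2)).
  { exists (mkposreal x Hx). intros t Ht. symmetry. apply bessel_I_eq.
    unfold ball in Ht; simpl in Ht. unfold AbsRing_ball, abs, minus, plus, opp in Ht;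
      simpl in Ht. apply Rabs_def2 in Ht. lra. }
  rewrite !bessel_I_eq by exact Hx. rewrite Rpower_plus, Rpower_1 by lra.
  replace (Rpower (x / 2) nu * (x / 2) * bessel_P (nu + 1) ((x / 2) ^ 2) +
     nu / x * (Rpower (x / 2) nu * bessel_P nu ((x / 2) ^ 2)))
   with (nu / x * Rpower (x / 2) nu * bessel_P nu ((x / 2) ^ 2)
     + Rpower (x / 2) nu * (x / 2 * bessel_P (nu + 1) ((x / 2) ^ 2))) by ring.
  apply (is_derive_mult (fun t => Rpower (t / 2) nu)
           (fun t => bessel_P nu ((t / 2) ^ 2)) x); [| |apply Rmult_comm].
  - unfold Rpower. auto_derive; [lra|]. change (x * / 2) with (x / 2). field. lra.
  - apply (is_derive_comp (bessel_P nu) (fun t => (t / 2) ^ 2) x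
             (bessel_P (nu + 1) ((x / 2) ^ 2)) (x / 2));
      [apply is_derive_bessel_P|]. auto_derive; [trivial|]. field.
Qed.

Lemma bessel_I_wronskian (nu x : R) : 0 < x ->
  bessel_I (nu + 1) x * bessel_I (- nu) x - bessel_I nu x * bessel_I (- nu - 1) x
  = 2 * sin (nu * PI) / (PI * x).
Proof.
  intros Hx. rewrite !bessel_I_eq by exact Hx.
  pose proof (bessel_P_wronskian nu ((x / 2) ^ 2) (pow2_ge_0 _)) as W.
  pose proof (Rpower_pos (x / 2) nu) as Hp. pose proof PI_RGT_0.
  replace (- nu - 1) with (- (nu + 1)) in * by ring.
  rewrite !Rpower_Ropp, Rpower_plus, Rpower_1 by lra.
  set (p := Rpower (x / 2) nu) in *.
  set (a := bessel_P nu _) in *. set (b := bessel_P (- (nu + 1)) _) in *.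
  set (c := bessel_P (nu + 1) _) in *. set (d := bessel_P (- nu) _) in *.
  transitivity (- (2 / x) * (a * b - (x / 2) ^ 2 * c * d)); [field; lra|].
  rewrite W. field. lra.
Qed.

(** This is I_(nu+1) <= I_nu at x = 2h. Two copies of the series of P_nu are arranged in sums of
    neighbouring terms, with half of the constant term left over; each sum dominates a term of 2h
    P_(nu+1) because (n+1) + h^2/(n+1) >= 2h. *)
Lemma bessel_P_succ_le (nu h : R) : 0 <= nu -> 0 < h ->
  h * bessel_P (nu + 1) (h ^ 2) <= bessel_P nu (h ^ 2).
Proof.
  intros Hnu Hh. set (z := h ^ 2).
  assert (Hz : 0 < z) by (unfold z; nra).
  assert (H : 2 * h * bessel_P (nu + 1) z <= 2 * bessel_P nu z).
  { unfold bessel_P, PSeries. rewrite <- Series_scal_l.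
    apply Rle_trans with (Series (fun n => bessel_coef nu n * z ^ n + bessel_coef nu (S n) * z ^ S n)).
    - apply Series_le.
      + intros n. pose proof (bessel_coef_pos (nu + 1) n ltac:(lra)) as Hc.
        pose proof (pow_lt z n Hz) as Hp.
        assert (0 < bessel_coef (nu + 1) n * z ^ n) by now apply Rmult_lt_0_compat.
        pose proof (pos_INR n).
        split; [apply Rmult_le_pos; lra|].
        rewrite (bessel_coef_shift nu n).
        replace (bessel_coef nu (S n)) with (bessel_coef (nu + 1) n / (INR n + 1))
          by (rewrite <- bessel_coef_S, S_INR; field; lra).
        replace ((INR n + nu + 1) * bessel_coef (nu + 1) n * z ^ n
                 + bessel_coef (nu + 1) n / (INR n + 1) * z ^ S n)
          with (bessel_coef (nu + 1) n * z ^ n * (INR n + nu + 1 + z / (INR n + 1)))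
          by (simpl; field; lra).
        rewrite (Rmult_comm (2 * h)). apply Rmult_le_compat_l; [lra|].
        apply Rle_trans with (INR n + 1 + z / (INR n + 1)); [|lra].
        apply Rminus_le_0.
        replace (INR n + 1 + z / (INR n + 1) - 2 * h)
          with ((INR n + 1 - h) ^ 2 / (INR n + 1)) by (unfold z; field; lra).
        apply Rdiv_le_0_compat; [apply pow2_ge_0|lra].
      + apply (ex_series_plus (V := R_NormedModule)); [apply ex_series_bessel|].
        apply (ex_series_incr_1 (fun k => bessel_coef nu k * z ^ k)), ex_series_bessel.
    - rewrite Series_plus; [|apply ex_series_bessel|].
      2: apply (ex_series_incr_1 (fun k => bessel_coef nu k * z ^ k)), ex_series_bessel.
      rewrite (Series_incr_1 (fun k => bessel_coef nu k * z ^ k)) at 2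
        by apply ex_series_bessel.
      rewrite (Series_incr_1 (fun k => bessel_coef nu k * z ^ k)) at 1
        by apply ex_series_bessel.
      pose proof (bessel_coef_pos nu 0 ltac:(lra)). rewrite pow_O. lra. }
  lra.
Qed.

(** With y = n + mu + 1, log-convexity bounds h^s times the n-th coefficient of P_(mu+s) below by
    (h/y)^s times that of P_mu, and (h/y)^s >= 1 + s (1 - y/h). The loss y/h is unbounded in n but
    linear, so it can be summed: y times the coefficient of P_mu belongs to P_(mu-1) + P_mu, and
    P_(mu-1) = z P_(mu+1) + mu P_mu is at most (h + mu) P_mu. *)
Lemma bessel_P_add_ge (mu s h : R) : 0 <= mu -> 0 <= s <= 1 -> 0 < h ->
  (1 - (mu + 1) / h) * bessel_P mu (h ^ 2) <= Rpower h s * bessel_P (mu + s) (h ^ 2).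
Proof.
  intros Hmu Hs Hh. set (z := h ^ 2).
  assert (Hz : 0 < z) by (unfold z; nra).
  assert (H : (1 + s) * bessel_P mu z <= Rpower h s * bessel_P (mu + s) z
              + s / h * (bessel_P (mu - 1) z + bessel_P mu z)).
  { unfold bessel_P, PSeries.
    rewrite <- Series_plus, <- !Series_scal_l, <- Series_plus;
      try apply (ex_series_scal (V := R_NormedModule));
      try apply (ex_series_plus (V := R_NormedModule));
      try apply ex_series_bessel.
    apply Series_le.
    2: { apply (ex_series_plus (V := R_NormedModule));
      apply (ex_series_scal (V := R_NormedModule));
      try apply (ex_series_plus (V := R_NormedModule)); apply ex_series_bessel. }
    intros n. pose proof (pow_lt z n Hz) as Hp.
    pose proof (bessel_coef_pos mu n ltac:(lra)) as Hc.
    pose proof (pos_INR n) as Hn.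
    split; [apply Rmult_le_pos; [lra|]; apply Rmult_le_pos; lra|].
    rewrite (bessel_coef_shift (mu - 1) n). replace (mu - 1 + 1) with mu by ring.
    set (y := INR n + mu + 1).
    assert (Hy : 0 < y) by (unfold y; lra).
    assert (Hhy : 0 < h / y) by now apply Rdiv_lt_0_compat.
    assert (Hpow : 1 + s * (1 - y / h) <= Rpower (h / y) s).
    { apply Rle_trans with (1 + s * ln (h / y)); [|apply exp_ineq1_le].
      apply Rplus_le_compat_l, Rmult_le_compat_l; [lra|].
      assert (Hyh : 0 < y / h) by now apply Rdiv_lt_0_compat.
      pose proof (ln_le_sub1 _ Hyh) as L.
      replace (h / y) with (/ (y / h)) by (field; lra).
      rewrite ln_Rinv by exact Hyh. lra. }
    assert (Hcoef : bessel_coef mu n * Rpower (h / y) s <= Rpower h s * bessel_coef (mu + s) n).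
    { unfold bessel_coef.
      pose proof (rGamma_add_ge y s Hy Hs) as G.
      replace (INR n + (mu + s) + 1) with (y + s) by (unfold y; ring).
      fold y. pose proof (INR_fact_pos n) as Hf.
      unfold Rdiv at 2. rewrite <- Rpower_mult_distr; [|exact Hh|now apply Rinv_0_lt_compat].
      replace (rGamma y / INR (fact n) * (Rpower h s * Rpower (/ y) s))
        with (Rpower h s / INR (fact n) * (rGamma y * Rpower (/ y) s)) by (field; lra).
      replace (Rpower h s * (rGamma (y + s) / INR (fact n)))
        with (Rpower h s / INR (fact n) * rGamma (y + s)) by (field; lra).
      apply Rmult_le_compat_l; [|exact G].
      left. apply Rdiv_lt_0_compat; [apply Rpower_pos|exact Hf]. }
    assert (Hc2 : bessel_coef mu n * (1 + s * (1 - y / h)) <= Rpower h s * bessel_coef (mu + s) n).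
    { eapply Rle_trans; [|exact Hcoef]. apply Rmult_le_compat_l; lra. }
    apply Rle_trans with ((bessel_coef mu n * (1 + s * (1 - y / h)) + s / h * (y * bessel_coef mu n)) * z ^ n).
    - right. field. lra.
    - replace (Rpower h s * (bessel_coef (mu + s) n * z ^ n) +
        s / h * ((INR n + (mu - 1) + 1) * bessel_coef mu n * z ^ n + bessel_coef mu n * z ^ n))
        with ((Rpower h s * bessel_coef (mu + s) n + s / h * (y * bessel_coef mu n)) * z ^ n)
        by (unfold y; field; lra).
      apply Rmult_le_compat_r; lra. }
  pose proof (bessel_P_rec (mu - 1) z) as R1. replace (mu - 1 + 1) with mu in R1 by ring.
  pose proof (bessel_P_succ_le mu h Hmu Hh) as S1. fold z in S1.
  pose proof (bessel_P_pos mu z ltac:(lra) ltac:(lra)) as Ppos.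
  assert (S2 : s / h * bessel_P (mu - 1) z <= s / h * ((h + mu) * bessel_P mu z)).
  { apply Rmult_le_compat_l; [apply Rdiv_le_0_compat; lra|].
    rewrite R1. apply (Rmult_le_compat_l h) in S1; [|lra].
    replace (z * bessel_P (mu + 1) z) with (h * (h * bessel_P (mu + 1) z)) by (unfold z; ring).
    lra. }
  replace (s / h * ((h + mu) * bessel_P mu z))
    with (s * bessel_P mu z + s * (mu / h) * bessel_P mu z) in S2 by (field; lra).
  assert (S3 : s * ((mu + 1) / h) * bessel_P mu z <= (mu + 1) / h * bessel_P mu z).
  { apply Rmult_le_compat_r; [lra|].
    assert (0 < (mu + 1) / h) by (apply Rdiv_lt_0_compat; lra). nra. }
  replace (s * ((mu + 1) / h)) with (s * (mu / h) + s / h) in S3 by (field; lra).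
  lra.
Qed.

Lemma bessel_I_add_ge (mu s x : R) : 0 <= mu -> 0 <= s <= 1 -> 0 < x ->
  (1 - 2 * (mu + 1) / x) * bessel_I mu x <= bessel_I (mu + s) x.
Proof.
  intros Hmu Hs Hx. rewrite !bessel_I_eq by exact Hx.
  rewrite Rpower_plus.
  pose proof (bessel_P_add_ge mu s (x / 2) Hmu Hs ltac:(lra)) as H.
  replace (2 * (mu + 1) / x) with ((mu + 1) / (x / 2)) by (field; lra).
  apply (Rmult_le_compat_l (Rpower (x / 2) mu)) in H; [lra|].
  left; apply Rpower_pos.
Qed.

(** * The function K for non-integer order *)

Lemma sin_succ_PI (nu : R) : sin ((nu + 1) * PI) = - sin (nu * PI).
Proof. rewrite Rmult_plus_distr_r, Rmult_1_l. apply neg_sin. Qed.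

Lemma sin_opp_PI (nu : R) : sin (- nu * PI) = - sin (nu * PI).
Proof. rewrite Ropp_mult_distr_l_reverse. apply sin_neg. Qed.

Lemma bessel_K_quotient_opp (nu x : R) :
  bessel_K_quotient (- nu) x = bessel_K_quotient nu x.
Proof.
  unfold bessel_K_quotient. rewrite sin_opp_PI, Ropp_involutive.
  unfold Rdiv. rewrite Rinv_opp. ring.
Qed.

Lemma bessel_K_quotient_rec (nu x : R) : 0 < x -> sin (nu * PI) <> 0 ->
  bessel_K_quotient (nu + 1) x
  = bessel_K_quotient (nu - 1) x + 2 * nu / x * bessel_K_quotient nu x.
Proof.
  intros Hx Hs. unfold bessel_K_quotient.
  pose proof (sin_succ_PI (nu - 1)) as E. replace (nu - 1 + 1) with nu in E by ring.
  rewrite sin_succ_PI. replace (sin ((nu - 1) * PI)) with (- sin (nu * PI)) by lra.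
  pose proof (bessel_I_rec (nu - 1) x Hx) as R1.
  pose proof (bessel_I_rec (- nu - 1) x Hx) as R2.
  replace (nu - 1 + 1) with nu in R1 by ring.
  replace (- nu - 1 + 1) with (- nu) in R2 by ring.
  replace (- (nu + 1)) with (- nu - 1) by ring.
  replace (- (nu - 1)) with (- nu + 1) by ring.
  rewrite R1, R2. field. lra.
Qed.

Lemma bessel_IK_cross (nu x : R) : 0 < x -> sin (nu * PI) <> 0 ->
  bessel_I nu x * bessel_K_quotient (nu + 1) x
  + bessel_I (nu + 1) x * bessel_K_quotient nu x = / x.
Proof.
  intros Hx Hs. unfold bessel_K_quotient. rewrite sin_succ_PI.
  pose proof (bessel_I_wronskian nu x Hx) as W. pose proof PI_RGT_0.
  replace (- (nu + 1)) with (- nu - 1) by ring.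
  transitivity (PI / (2 * sin (nu * PI)) *
    (bessel_I (nu + 1) x * bessel_I (- nu) x - bessel_I nu x * bessel_I (- nu - 1) x));
    [field; lra|].
  rewrite W. field. lra.
Qed.

Lemma dbessel_I_pos (nu x : R) : 0 <= nu -> 0 < x -> 0 < dbessel_I nu x.
Proof.
  intros Hnu Hx. unfold dbessel_I.
  pose proof (bessel_I_pos nu x ltac:(lra) Hx).
  pose proof (bessel_I_pos (nu + 1) x ltac:(lra) Hx).
  assert (0 <= nu / x * bessel_I nu x)
    by (apply Rmult_le_pos; [apply Rdiv_le_0_compat|]; lra).
  lra.
Qed.

Lemma bessel_I_lt (nu x y : R) : 0 <= nu -> 0 < x -> x < y -> bessel_I nu x < bessel_I nu y.
Proof.
  intros Hnu Hx Hxy.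
  destruct (MVT_gen (bessel_I nu) x y (dbessel_I nu)) as [c [Hc E]].
  - intros t Ht. rewrite Rmin_left in Ht by lra. apply is_derive_bessel_I; lra.
  - intros t Ht. rewrite Rmin_left in Ht by lra.
    apply derivable_continuous_pt, ex_derive_Reals_0.
    eexists. apply is_derive_bessel_I; lra.
  - rewrite Rmin_left in Hc by lra.
    pose proof (dbessel_I_pos nu c Hnu ltac:(lra)). nra.
Qed.

Definition dbessel_K (nu x : R) : R :=
  PI / 2 * ((dbessel_I (- nu) x - dbessel_I nu x) / sin (nu * PI)).

Lemma is_derive_bessel_K_quotient (nu x : R) : 0 < x ->
  is_derive (bessel_K_quotient nu) x (dbessel_K nu x).
Proof.
  intros Hx. unfold bessel_K_quotient, dbessel_K.
  apply (is_derive_scal (fun x => (bessel_I (- nu) x - bessel_I nu x) / sin (nu * PI))).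
  unfold Rdiv.
  apply is_derive_ext with
    (fun t => / sin (nu * PI) * (bessel_I (- nu) t - bessel_I nu t)); [intros; apply Rmult_comm|].
  rewrite (Rmult_comm (dbessel_I (- nu) x - dbessel_I nu x)).
  apply (is_derive_scal (fun x => bessel_I (- nu) x - bessel_I nu x)).
  apply (is_derive_minus (V := R_NormedModule)); now apply is_derive_bessel_I.
Qed.

Lemma bessel_IK_wronskian (nu x : R) : 0 < x -> sin (nu * PI) <> 0 ->
  dbessel_I nu x * bessel_K_quotient nu x - bessel_I nu x * dbessel_K nu x = / x.
Proof.
  intros Hx Hs. unfold bessel_K_quotient, dbessel_K, dbessel_I.
  pose proof (bessel_I_wronskian nu x Hx) as W. pose proof PI_RGT_0.
  pose proof (bessel_I_rec (- nu - 1) x Hx) as R2.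
  replace (- nu - 1 + 1) with (- nu) in R2 by ring.
  transitivity (PI / (2 * sin (nu * PI)) *
    (bessel_I (nu + 1) x * bessel_I (- nu) x - bessel_I nu x * bessel_I (- nu - 1) x)).
  - rewrite R2. field. lra.
  - rewrite W. field. lra.
Qed.

(** The derivative -1/(t I^2) is smallest in size at the right endpoint, because t I_nu(t)^2
    increases. The explicit gap is kept because it later bounds K from below by I alone. *)
Lemma bessel_KI_ratio_decr (nu x y : R) : 0 <= nu -> sin (nu * PI) <> 0 ->
  0 < x -> x < y ->
  (y - x) / (y * bessel_I nu y ^ 2)
  <= bessel_K_quotient nu x / bessel_I nu x - bessel_K_quotient nu y / bessel_I nu y.
Proof.
  intros Hnu Hs Hx Hxy.
  assert (HD : forall t, 0 < t ->
    is_derive (fun t => bessel_K_quotient nu t / bessel_I nu t) t (- / (t * bessel_I nu t ^ 2))).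
  { intros t Ht. pose proof (bessel_I_pos nu t ltac:(lra) Ht) as Hp.
    replace (- / (t * bessel_I nu t ^ 2)) with
      ((dbessel_K nu t * bessel_I nu t - bessel_K_quotient nu t * dbessel_I nu t) / bessel_I nu t ^ 2).
    - apply is_derive_div; [now apply is_derive_bessel_K_quotient|now apply is_derive_bessel_I|lra].
    - pose proof (bessel_IK_wronskian nu t Ht Hs) as W.
      replace (dbessel_K nu t * bessel_I nu t - bessel_K_quotient nu t * dbessel_I nu t)
        with (- / t) by lra. field. lra. }
  destruct (MVT_gen (fun t => bessel_K_quotient nu t / bessel_I nu t) x y
              (fun t => - / (t * bessel_I nu t ^ 2))) as [c [Hc E]].
  - intros t Ht. rewrite Rmin_left in Ht by lra. apply HD; lra.
  - intros t Ht. rewrite Rmin_left in Ht by lra.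
    apply derivable_continuous_pt, ex_derive_Reals_0.
    eexists. apply HD; lra.
  - rewrite Rmin_left, Rmax_right in Hc by lra.
    pose proof (bessel_I_pos nu c ltac:(lra) ltac:(lra)) as Hp.
    assert (bessel_I nu c <= bessel_I nu y).
    { destruct (Req_dec c y) as [->|Hne]; [lra|]. left. apply bessel_I_lt; lra. }
    apply Rle_trans with ((y - x) * / (c * bessel_I nu c ^ 2)); [|lra].
    apply Rmult_le_compat_l; [lra|]. apply Rinv_le_contravar.
    + apply Rmult_lt_0_compat; [lra|nra].
    + apply Rmult_le_compat; [lra|nra|lra|]. apply pow_incr; lra.
Qed.

(* [I_{-nu} >= I_{2-nu} >= (1 - O(1/x)) I_1 >= (1 - O(1/x))^2 I_nu], so the
   decreasing function K/I cannot become negative. *)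
Lemma bessel_K_quotient_pos_01 (nu x : R) : 0 < nu < 1 -> 0 < x ->
  0 < bessel_K_quotient nu x.
Proof.
  intros Hnu Hx.
  assert (Hs : 0 < sin (nu * PI)) by (apply sin_gt_0; pose proof PI_RGT_0; nra).
  pose proof PI_RGT_0 as HPI.
  (* Each of the two comparisons, from nu to 1 and from 1 to 2 - nu, costs at most a factor 1 - 4/t,
     and (1 - 4/t)^2 >= 1 - 8/t. *)
  assert (Hlow : forall t, 8 < t -> (1 - 8 / t) * bessel_I nu t <= bessel_I (- nu) t).
  { intros t Ht.
    pose proof (bessel_I_rec (- nu) t ltac:(lra)) as R1.
    pose proof (bessel_I_pos (- nu + 1) t ltac:(lra) ltac:(lra)) as P1.
    pose proof (bessel_I_pos nu t ltac:(lra) ltac:(lra)) as P2.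
    pose proof (bessel_I_pos 1 t ltac:(lra) ltac:(lra)) as P3.
    assert (0 < 2 * (- nu + 1) / t * bessel_I (- nu + 1) t)
      by (apply Rmult_lt_0_compat; [apply Rdiv_lt_0_compat|]; lra).
    pose proof (bessel_I_add_ge 1 (- nu + 1) t ltac:(lra) ltac:(lra) ltac:(lra)) as A1.
    replace (1 + (- nu + 1)) with (- nu + 1 + 1) in A1 by ring.
    pose proof (bessel_I_add_ge nu (1 - nu) t ltac:(lra) ltac:(lra) ltac:(lra)) as A2.
    replace (nu + (1 - nu)) with 1 in A2 by ring.
    assert (Hi : 0 < / t < / 8) by (split; [apply Rinv_0_lt_compat|apply Rinv_lt_contravar]; lra).
    unfold Rdiv in *. set (i := / t) in *.
    assert (A2' : (1 - 4 * i) * bessel_I nu t <= bessel_I 1 t).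
    { eapply Rle_trans; [|exact A2]. apply Rmult_le_compat_r; [lra|]. nra. }
    assert ((1 - 4 * i) * ((1 - 4 * i) * bessel_I nu t) <= (1 - 4 * i) * bessel_I 1 t)
      by (apply Rmult_le_compat_l; lra).
    assert ((1 - 8 * i) * bessel_I nu t <= (1 - 4 * i) * (1 - 4 * i) * bessel_I nu t)
      by (apply Rmult_le_compat_r; [lra|nra]).
    replace (1 - 2 * (1 + 1) * i) with (1 - 4 * i) in A1 by ring. lra. }
  assert (Hnn : forall u, 0 < u -> 0 <= bessel_K_quotient nu u / bessel_I nu u).
  { intros u Hu. apply Rnot_lt_le. intros Hneg.
    set (d := - (bessel_K_quotient nu u / bessel_I nu u)) in *.
    assert (Hd : 0 < d) by (unfold d; lra).
    (* In terms of I_(-nu)/I_nu - 1, a ratio K/I equal to -d means the value -e; the point t below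
       is so large that 8/t < e. *)
    set (e := d * (2 / PI * sin (nu * PI))).
    assert (He : 0 < e).
    { unfold e. apply Rmult_lt_0_compat; [lra|]. apply Rmult_lt_0_compat; [apply Rdiv_lt_0_compat|]; lra. }
    assert (H8e : 0 < 8 / e) by (apply Rdiv_lt_0_compat; lra).
    set (t := u + 8 + 8 / e).
    assert (Ht : 8 < t) by (unfold t; lra).
    pose proof (Hlow t Ht) as L.
    pose proof (bessel_I_pos nu t ltac:(lra) ltac:(lra)) as Pt.
    pose proof (bessel_KI_ratio_decr nu u t ltac:(lra) ltac:(lra) Hu ltac:(unfold t; lra)) as Q.
    assert (0 < (t - u) / (t * bessel_I nu t ^ 2)).
    { apply Rdiv_lt_0_compat; [unfold t; lra|]. apply Rmult_lt_0_compat; [lra|nra]. }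
    assert (Q1 : bessel_K_quotient nu t / bessel_I nu t < - d) by (unfold d; lra).
    assert (Q2 : bessel_K_quotient nu t / bessel_I nu t
       = (bessel_I (- nu) t / bessel_I nu t - 1) * (PI / 2 / sin (nu * PI)))
      by (unfold bessel_K_quotient; field; lra).
    assert (Q3 : - (8 / t) <= bessel_I (- nu) t / bessel_I nu t - 1).
    { assert (1 - 8 / t <= bessel_I (- nu) t / bessel_I nu t); [|lra].
      apply (proj1 (Rle_div_r _ _ _ Pt)). exact L. }
    assert (Q4 : - e < - (8 / t)).
    { assert (8 / t < e); [|lra].
      apply (Rmult_lt_reg_l (t / e)); [apply Rdiv_lt_0_compat; lra|].
      replace (t / e * (8 / t)) with (8 / e) by (field; lra).
      replace (t / e * e) with t by (field; lra). unfold t. lra. }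
    assert (Hk : 0 < PI / 2 / sin (nu * PI)) by (apply Rdiv_lt_0_compat; lra).
    assert (- e * (PI / 2 / sin (nu * PI)) <= bessel_K_quotient nu t / bessel_I nu t).
    { rewrite Q2. apply Rmult_le_compat_r; lra. }
    replace (- e * (PI / 2 / sin (nu * PI))) with (- d) in H0; [lra|].
    unfold e. field. lra. }
  (* Nonnegativity at x + 1 together with the strict drop of the ratio from x to x + 1 gives
     positivity at x. *)
  pose proof (bessel_KI_ratio_decr nu x (x + 1) ltac:(lra) ltac:(lra) Hx ltac:(lra)) as Q.
  pose proof (Hnn (x + 1) ltac:(lra)).
  pose proof (bessel_I_pos nu (x + 1) ltac:(lra) ltac:(lra)).
  pose proof (bessel_I_pos nu x ltac:(lra) Hx).
  assert (0 < (x + 1 - x) / ((x + 1) * bessel_I nu (x + 1) ^ 2)).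
  { apply Rdiv_lt_0_compat; [lra|]. apply Rmult_lt_0_compat; [lra|nra]. }
  replace (bessel_K_quotient nu x)
    with (bessel_K_quotient nu x / bessel_I nu x * bessel_I nu x) by (field; lra).
  apply Rmult_lt_0_compat; lra.
Qed.

Lemma bessel_K_quotient_pos (nu x : R) : 0 < nu -> sin (nu * PI) <> 0 -> 0 < x ->
  0 < bessel_K_quotient nu x.
Proof.
  intros Hnu Hs Hx.
  assert (H : forall (n : nat) mu, 0 < mu < INR n + 1 -> sin (mu * PI) <> 0 ->
    0 < bessel_K_quotient mu x).
  { induction n as [|n IH]; intros mu Hmu Hsm.
    - simpl in Hmu. apply bessel_K_quotient_pos_01; lra.
    - rewrite S_INR in Hmu. pose proof (pos_INR n).
      destruct (Rlt_dec mu 1) as [H1|H1]; [apply bessel_K_quotient_pos_01; lra|].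
      assert (mu <> 1) by (intros ->; apply Hsm; rewrite Rmult_1_l; apply sin_PI).
      assert (mu <> 2) by (intros ->; apply Hsm, sin_2PI).
      pose proof (sin_succ_PI (mu - 1)) as E1.
      replace (mu - 1 + 1) with mu in E1 by ring.
      pose proof (sin_succ_PI (mu - 1 - 1)) as E2.
      replace (mu - 1 - 1 + 1) with (mu - 1) in E2 by ring.
      pose proof (bessel_K_quotient_rec (mu - 1) x Hx ltac:(lra)) as R1.
      replace (mu - 1 + 1) with mu in R1 by ring. rewrite R1.
      apply Rplus_lt_0_compat.
      (* For 1 < mu < 2 the order mu - 2 lies in (-1, 0), and K is even in the order. *)
      + destruct (Rlt_dec mu 2) as [Hlt|Hge].
        * rewrite <- bessel_K_quotient_opp. apply bessel_K_quotient_pos_01; lra.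
        * apply IH; lra.
      + apply Rmult_lt_0_compat; [apply Rdiv_lt_0_compat; lra|]. apply IH; lra. }
  destruct (INR_unbounded nu) as [n Hn]. apply (H n); lra.
Qed.

(* The derivative of [I K + ln] is [2 I' K] by the Wronskian, and
   [K >= (K(y)/I(y)) I] on [(0, y]]; the lower bound is expressed through I
   alone so that it survives the limit to integer order. *)
Lemma bessel_IK_ln_increase (nu x y : R) : 0 < nu -> sin (nu * PI) <> 0 ->
  0 < x -> x < y ->
  (bessel_I nu y ^ 2 - bessel_I nu x ^ 2) / (2 * bessel_I nu (2 * y) ^ 2)
  <= bessel_I nu y * bessel_K_quotient nu y + ln y
     - (bessel_I nu x * bessel_K_quotient nu x + ln x).
Proof.
  intros Hnu Hs Hx Hxy.
  (* The ratio K/I is compared with its positive value at 2y: for t <= y the gap 2y - t is at least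
     y, which bounds K/I below by k on all of (0, y]. *)
  set (k := / (2 * bessel_I nu (2 * y) ^ 2)).
  pose proof (bessel_I_pos nu (2 * y) ltac:(lra) ltac:(lra)) as P2y.
  assert (Hk : forall t, 0 < t <= y -> k * bessel_I nu t <= bessel_K_quotient nu t).
  { intros t Ht.
    pose proof (bessel_KI_ratio_decr nu t (2 * y) ltac:(lra) Hs ltac:(lra) ltac:(lra)) as Q.
    pose proof (bessel_I_pos nu t ltac:(lra) ltac:(lra)) as Pt.
    pose proof (bessel_K_quotient_pos nu (2 * y) Hnu Hs ltac:(lra)) as PK.
    assert (0 < bessel_K_quotient nu (2 * y) / bessel_I nu (2 * y))
      by now apply Rdiv_lt_0_compat.
    apply (proj2 (Rle_div_r _ _ _ Pt)).
    apply Rle_trans with ((2 * y - t) / (2 * y * bessel_I nu (2 * y) ^ 2)); [|lra].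
    unfold k.
    replace (/ (2 * bessel_I nu (2 * y) ^ 2))
      with (y / (2 * y * bessel_I nu (2 * y) ^ 2)) by (field; lra).
    apply Rmult_le_compat_r; [|lra]. left. apply Rinv_0_lt_compat.
    apply Rmult_lt_0_compat; [lra|nra]. }
  (* By the Wronskian h' = 2 I' (K - k I), which is nonnegative on (0, y]. *)
  set (h := fun t => bessel_I nu t * bessel_K_quotient nu t + ln t - k * (bessel_I nu t * bessel_I nu t)).
  assert (HD : forall t, 0 < t -> is_derive h t
     (dbessel_I nu t * bessel_K_quotient nu t + bessel_I nu t * dbessel_K nu t + / t
       - k * (dbessel_I nu t * bessel_I nu t + bessel_I nu t * dbessel_I nu t))).
  { intros t Ht. unfold h.
    pose proof (is_derive_bessel_I nu t Ht) as DI.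
    pose proof (is_derive_bessel_K_quotient nu t Ht) as DK.
    apply (is_derive_minus (V := R_NormedModule)).
    - apply (is_derive_plus (V := R_NormedModule)); [|now apply is_derive_ln].
      apply (is_derive_mult (bessel_I nu) (bessel_K_quotient nu)); try assumption.
      apply Rmult_comm.
    - apply (is_derive_scal (fun t => bessel_I nu t * bessel_I nu t)).
      apply (is_derive_mult (bessel_I nu) (bessel_I nu)); try assumption.
      apply Rmult_comm. }
  destruct (MVT_gen h x y (fun t =>
     dbessel_I nu t * bessel_K_quotient nu t + bessel_I nu t * dbessel_K nu t + / t
       - k * (dbessel_I nu t * bessel_I nu t + bessel_I nu t * dbessel_I nu t))) as [c [Hc E]].
  - intros t Ht. rewrite Rmin_left in Ht by lra. apply HD; lra.
  - intros t Ht. rewrite Rmin_left in Ht by lra.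
    apply derivable_continuous_pt, ex_derive_Reals_0.
    eexists. apply HD; lra.
  - rewrite Rmin_left, Rmax_right in Hc by lra.
    pose proof (bessel_IK_wronskian nu c ltac:(lra) Hs) as W.
    pose proof (dbessel_I_pos nu c ltac:(lra) ltac:(lra)) as Dp.
    pose proof (Hk c ltac:(lra)) as Kc.
    assert (0 <= h y - h x).
    { rewrite E. apply Rmult_le_pos; [|lra].
      rewrite <- W.
      replace (dbessel_I nu c * bessel_K_quotient nu c + bessel_I nu c * dbessel_K nu c +
        (dbessel_I nu c * bessel_K_quotient nu c - bessel_I nu c * dbessel_K nu c) -
        k * (dbessel_I nu c * bessel_I nu c + bessel_I nu c * dbessel_I nu c))
        with (2 * dbessel_I nu c * (bessel_K_quotient nu c - k * bessel_I nu c)) by ring.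
      apply Rmult_le_pos; lra. }
    unfold Rdiv. fold k. unfold h in H. lra.
Qed.

(** * Dependence on the order near an integer *)

Fixpoint harmonic (n : nat) : R :=
  match n with
  | O => 0
  | S k => harmonic k + / INR (S k)
  end.

Lemma harmonic_S (n : nat) : harmonic (S n) = harmonic n + / INR (S n).
Proof. reflexivity. Qed.

Lemma sum_inv_harmonic (n : nat) :
  sum_f_R0 (fun k : nat => / INR (S k)) n = harmonic (S n).
Proof.
  induction n as [|n IH]; [simpl; ring|]. rewrite tech5, IH. reflexivity.
Qed.

Lemma ln_succ_bounds (m : R) : 0 < m -> / (m + 1) <= ln (m + 1) - ln m <= / m.
Proof.
  intros Hm. rewrite <- ln_div by lra. split.
  - assert (H : 0 < m / (m + 1)) by (apply Rdiv_lt_0_compat; lra).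
    pose proof (ln_le_sub1 _ H) as L. rewrite ln_div in * by lra.
    replace (m / (m + 1) - 1) with (- / (m + 1)) in L by (field; lra). lra.
  - assert (H : 0 < (m + 1) / m) by (apply Rdiv_lt_0_compat; lra).
    pose proof (ln_le_sub1 _ H) as L.
    replace ((m + 1) / m - 1) with (/ m) in L by (field; lra). lra.
Qed.

Lemma harmonic_ln_decr (n : nat) :
  harmonic (S (S n)) - ln (INR (S (S n))) <= harmonic (S n) - ln (INR (S n)).
Proof.
  rewrite (harmonic_S (S n)), (S_INR (S n)).
  pose proof (ln_succ_bounds (INR (S n)) ltac:(apply lt_0_INR; lia)). lra.
Qed.

(** The induction closes for the bound 1/(n+1) where it would not for 0: each step uses up exactly
    the previous bound, through ln (m+1) - ln m <= 1/m. *)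
Lemma harmonic_ln_ge (n : nat) : / INR (S n) <= harmonic (S n) - ln (INR (S n)).
Proof.
  induction n as [|n IH].
  - simpl. rewrite ln_1. lra.
  - rewrite (harmonic_S (S n)), (S_INR (S n)).
    pose proof (ln_succ_bounds (INR (S n)) ltac:(apply lt_0_INR; lia)). lra.
Qed.

Lemma is_lim_euler_gamma :
  is_lim_seq (fun n : nat => harmonic (S n) - ln (INR (S n))) euler_gamma.
Proof.
  apply is_lim_seq_ext with
    (fun n : nat => sum_f_R0 (fun k : nat => / INR (S k)) n - ln (INR (S n))).
  { intros n. now rewrite sum_inv_harmonic. }
  apply (Lim_seq_correct' (fun n : nat =>
    sum_f_R0 (fun k : nat => / INR (S k)) n - ln (INR (S n)))).
  apply (ex_finite_lim_seq_decr _ 0); intros n; rewrite !sum_inv_harmonic.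
  - apply harmonic_ln_decr.
  - pose proof (harmonic_ln_ge n).
    assert (0 < / INR (S n)) by (apply Rinv_0_lt_compat, lt_0_INR; lia). lra.
Qed.

Lemma euler_gamma_bounds : 0 <= euler_gamma <= 1.
Proof.
  split.
  - apply (is_lim_seq_le (fun _ => 0) _ 0 _) with (2 := is_lim_seq_const 0)
      (3 := is_lim_euler_gamma).
    intros n. pose proof (harmonic_ln_ge n).
    assert (0 < / INR (S n)) by (apply Rinv_0_lt_compat, lt_0_INR; lia). lra.
  - apply (is_lim_seq_le _ (fun _ => 1) _ 1) with (2 := is_lim_euler_gamma)
      (3 := is_lim_seq_const 1).
    intros n. induction n as [|n IH]; [simpl; rewrite ln_1; lra|].
    eapply Rle_trans; [apply harmonic_ln_decr|exact IH].
Qed.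

(** * Second-order expansions of 1/Gamma and of the series coefficients in the order *)

Lemma exp_le_quadratic (u : R) : Rabs u <= / 2 -> exp u <= 1 + u + 2 * u ^ 2.
Proof.
  intros Hu. apply Rabs_le_between in Hu.
  pose proof (exp_ineq1_le (- u)) as H. rewrite exp_Ropp in H.
  apply Rle_trans with (/ (1 - u)).
  - rewrite <- (Rinv_inv (exp u)). apply Rinv_le_contravar; lra.
  - apply (Rmult_le_reg_r (1 - u)); [lra|]. rewrite Rinv_l by lra.
    assert (0 <= u ^ 2 * (1 - 2 * u)) by (apply Rmult_le_pos; [apply pow2_ge_0|lra]).
    nra.
Qed.

Lemma exp_le_one_plus (h : R) : - / 2 <= h -> exp (h - 2 * h ^ 2) <= 1 + h.
Proof.
  intros Hh. pose proof (exp_ineq1_le (- (h - 2 * h ^ 2))) as H. rewrite exp_Ropp in H.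
  assert (0 < 1 - h + 2 * h ^ 2) by nra.
  apply Rle_trans with (/ (1 - h + 2 * h ^ 2)).
  - rewrite <- (Rinv_inv (exp (h - 2 * h ^ 2))). apply Rinv_le_contravar; lra.
  - apply (Rmult_le_reg_r (1 - h + 2 * h ^ 2)); [lra|]. rewrite Rinv_l by lra.
    assert (0 <= h ^ 2 * (1 + 2 * h)) by (apply Rmult_le_pos; [apply pow2_ge_0|lra]).
    nra.
Qed.

(** Each factor is k (1 + h) with h = mu/k, and 1 + h lies between exp (h - 2 h^2) and exp h. The
    first-order terms add up to the harmonic number; 2 - 1/(m+1) bounds the sum of 1/k^2, since
    1/(M+1)^2 <= 1/M - 1/(M+1). *)
Lemma gauss_prod_one_bounds (mu : R) (m : nat) : Rabs mu <= / 2 ->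
  INR (fact (S m)) * exp (mu * harmonic (S m) - 2 * mu ^ 2 * (2 - / INR (S m)))
    <= prod_f_R0 (fun k : nat => 1 + mu + INR k) m
    <= INR (fact (S m)) * exp (mu * harmonic (S m)).
Proof.
  intros Hmu. apply Rabs_le_between in Hmu.
  induction m as [|m [IH1 IH2]].
  - simpl. rewrite Rplus_0_l, Rinv_1, !Rmult_1_r, !Rmult_1_l, Rplus_0_r.
    split.
    + pose proof (exp_le_one_plus mu ltac:(lra)) as H.
      replace (mu - 2 * (mu * mu) * (2 - 1)) with (mu - 2 * mu ^ 2) by ring. exact H.
    + apply exp_ineq1_le.
  - rewrite gauss_prod_S, (INR_fact_S (S m)), (harmonic_S (S m)).
    assert (Hm : 1 <= INR (S m)) by (rewrite S_INR; pose proof (pos_INR m); lra).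
    rewrite (S_INR (S m)).
    set (M := INR (S m)) in *.
    set (h := mu / (M + 1)).
    assert (Hi : 0 < / (M + 1) <= / 2).
    { split; [apply Rinv_0_lt_compat; lra|apply Rinv_le_contravar; lra]. }
    assert (Hh : - / 2 <= h) by (unfold h, Rdiv; nra).
    replace (1 + mu + M) with ((M + 1) * (1 + h)) by (unfold h; field; lra).
    pose proof (INR_fact_pos (S m)) as Hf.
    set (f := INR (fact (S m))) in *.
    set (p := prod_f_R0 (fun k : nat => 1 + mu + INR k) m) in *.
    pose proof (exp_le_one_plus h Hh) as L1. pose proof (exp_ineq1_le h) as L2.
    pose proof (exp_pos (h - 2 * h ^ 2)) as L0.
    split.
    + apply Rle_trans with ((M + 1) * f *
        (exp (mu * harmonic (S m) - 2 * mu ^ 2 * (2 - / M)) * exp (h - 2 * h ^ 2))).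
      * apply Rmult_le_compat_l; [apply Rmult_le_pos; lra|].
        rewrite <- exp_plus. apply exp_le.
        replace h with (mu * / (M + 1)) by reflexivity.
        assert (Hq : 0 <= / M - / (M + 1) - / (M + 1) * / (M + 1)).
        { replace (/ M - / (M + 1) - / (M + 1) * / (M + 1))
            with (/ M * / (M + 1) * / (M + 1)) by (field; lra).
          assert (0 < / M) by (apply Rinv_0_lt_compat; lra).
          repeat apply Rmult_le_pos; lra. }
        apply (Rmult_le_compat_l (2 * mu ^ 2)) in Hq; [|nra]. lra.
      * replace (p * ((M + 1) * (1 + h))) with ((M + 1) * (p * (1 + h))) by ring.
        rewrite Rmult_assoc. apply Rmult_le_compat_l; [lra|].
        rewrite <- Rmult_assoc.
        pose proof (exp_pos (mu * harmonic (S m) - 2 * mu ^ 2 * (2 - / M))).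
        apply Rmult_le_compat; try lra. apply Rmult_le_pos; lra.
    + replace (mu * (harmonic (S m) + / (M + 1))) with (mu * harmonic (S m) + h)
        by (unfold h, Rdiv; ring).
      rewrite exp_plus.
      replace (p * ((M + 1) * (1 + h))) with ((M + 1) * (p * (1 + h))) by ring.
      rewrite Rmult_assoc. apply Rmult_le_compat_l; [lra|].
      rewrite <- Rmult_assoc.
      pose proof (exp_pos (mu * harmonic (S m) - 2 * mu ^ 2 * (2 - / M))).
      assert (0 <= p) by (eapply Rle_trans; [|exact IH1]; apply Rmult_le_pos; lra).
      apply Rmult_le_compat; lra.
Qed.

Lemma rGamma_one_plus_bounds (mu : R) : Rabs mu <= / 2 ->
  exp (euler_gamma * mu - 4 * mu ^ 2) <= rGamma (1 + mu) <= exp (euler_gamma * mu).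
Proof.
  intros Hmu.
  (* With M = m + 1, the product bounds involve (M+1)! and H_(M+1), but the Gauss sequence is
     normalised by M! and M^(1+mu); the mismatch is c m = (1 + 1/M)^(1+mu). *)
  set (c := fun m : nat => exp ((1 + mu) * ln (1 + 1 / INR (S m)))).
  assert (Lc : is_lim_seq c 1).
  { replace (Finite 1) with (Finite (exp ((1 + mu) * ln 1)))
      by (rewrite ln_1, Rmult_0_r, exp_0; reflexivity).
    apply (is_lim_seq_continuous (fun t => exp ((1 + mu) * ln t))).
    - apply derivable_continuous_pt, ex_derive_Reals_0. auto_derive. lra.
    - apply is_lim_seq_one_plus_div. }
  assert (Lexp : forall b : R, is_lim_seq (fun m : nat =>
     c m * exp (mu * (harmonic (S (S m)) - ln (INR (S (S m)))) + b))
     (exp (euler_gamma * mu + b))).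
  { intros b.
    replace (Finite (exp (euler_gamma * mu + b)))
      with (Finite (1 * exp (mu * euler_gamma + b)))
      by (f_equal; rewrite (Rmult_comm mu); ring).
    apply is_lim_seq_mult'; [exact Lc|].
    apply (is_lim_seq_continuous (fun t => exp (mu * t + b))).
    - apply derivable_continuous_pt, ex_derive_Reals_0. auto_derive. trivial.
    - apply (is_lim_seq_incr_1 (fun n => harmonic (S n) - ln (INR (S n)))).
      exact is_lim_euler_gamma. }
  assert (Hg : forall m : nat,
    c m * exp (mu * (harmonic (S (S m)) - ln (INR (S (S m)))) + - 4 * mu ^ 2)
    <= gauss_seq (1 + mu) (S m)
    <= c m * exp (mu * (harmonic (S (S m)) - ln (INR (S (S m)))) + 0)).
  { intros m. unfold gauss_seq.
    pose proof (gauss_prod_one_bounds mu (S m) Hmu) as [B1 B2].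
    assert (HM : 0 < INR (S m)) by (apply lt_0_INR; lia).
    rewrite (INR_fact_S (S m)) in B1, B2. rewrite (S_INR (S m)) in *.
    pose proof (INR_fact_pos (S m)) as Hf.
    set (M := INR (S m)) in *. set (f := INR (fact (S m))) in *.
    set (p := prod_f_R0 _ _) in *. set (H := harmonic (S (S m))) in *.
    pose proof (Rpower_pos M (1 + mu)) as Hp.
    assert (Hc : forall b, c m * exp (mu * (H - ln (M + 1)) + b)
              = (M + 1) * f * exp (mu * H + b) / (f * Rpower M (1 + mu))).
    { intros b. unfold c. fold M.
      replace (1 + 1 / M) with ((M + 1) / M) by (field; lra).
      rewrite ln_div by lra.
      unfold Rpower.
      replace ((M + 1) * f * exp (mu * H + b) / (f * exp ((1 + mu) * ln M)))
        with ((M + 1) * exp (mu * H + b) * / exp ((1 + mu) * ln M))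
        by (field; split; [apply Rgt_not_eq, exp_pos|lra]).
      rewrite <- exp_Ropp.
      replace (M + 1) with (exp (ln (M + 1))) at 3 by (apply exp_ln; lra).
      rewrite <- !exp_plus. f_equal. ring. }
    rewrite !Hc.
    assert (Hden : 0 < f * Rpower M (1 + mu)) by now apply Rmult_lt_0_compat.
    split; (apply Rmult_le_compat_r; [left; now apply Rinv_0_lt_compat|]).
    - eapply Rle_trans; [|exact B1]. apply Rmult_le_compat_l; [apply Rmult_le_pos; lra|].
      apply exp_le.
      assert (0 < / (M + 1)) by (apply Rinv_0_lt_compat; lra).
      pose proof (pow2_ge_0 mu). nra.
    - rewrite Rplus_0_r. exact B2. }
  pose proof (is_lim_gauss_seq (1 + mu)) as LG. apply is_lim_seq_incr_1 in LG.
  split.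
  - replace (euler_gamma * mu - 4 * mu ^ 2) with (euler_gamma * mu + - 4 * mu ^ 2) by ring.
    exact (is_lim_seq_le _ _ _ _ (fun m => proj1 (Hg m)) (Lexp _) LG).
  - rewrite <- (Rplus_0_r (euler_gamma * mu)).
    exact (is_lim_seq_le _ _ _ _ (fun m => proj2 (Hg m)) LG (Lexp _)).
Qed.

Lemma is_derive_quadratic (f : R -> R) (l C : R) :
  (forall mu, Rabs mu <= / 2 -> Rabs (f mu - f 0 - l * mu) <= C * mu ^ 2) ->
  is_derive f 0 l.
Proof.
  intros H. apply is_derive_Reals. intros eps Heps.
  set (D := Rabs C + 1).
  assert (HD : 0 < D) by (unfold D; pose proof (Rabs_pos C); lra).
  assert (Hd : 0 < Rmin (/ 2) (eps / D)).
  { apply Rmin_pos; [lra|]. now apply Rdiv_lt_0_compat. }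
  exists (mkposreal _ Hd). intros h Hh0 Hh.
  change (Rabs h < Rmin (/ 2) (eps / D)) in Hh.
  pose proof (Rmin_l (/ 2) (eps / D)). pose proof (Rmin_r (/ 2) (eps / D)).
  specialize (H h ltac:(lra)). rewrite Rplus_0_l.
  replace ((f h - f 0) / h - l) with ((f h - f 0 - l * h) / h) by (field; exact Hh0).
  rewrite Rabs_div by exact Hh0.
  assert (Hp : 0 < Rabs h) by now apply Rabs_pos_lt.
  apply (proj2 (Rlt_div_l _ _ _ Hp)).
  eapply Rle_lt_trans; [exact H|].
  rewrite <- (pow2_abs h).
  assert (Rabs h * D < eps) by (apply (proj2 (Rlt_div_r _ _ _ HD)); lra).
  apply Rle_lt_trans with (Rabs h * D * Rabs h).
  - pose proof (Rle_abs C). unfold D. nra.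
  - apply Rmult_lt_compat_r; lra.
Qed.

Lemma is_derive_rGamma_one : is_derive (fun mu => rGamma (1 + mu)) 0 euler_gamma.
Proof.
  apply (is_derive_quadratic _ _ 4). intros mu Hmu.
  rewrite Rplus_0_r, rGamma_1.
  pose proof (rGamma_one_plus_bounds mu Hmu) as [B1 B2].
  pose proof euler_gamma_bounds as Hg.
  pose proof (exp_ineq1_le (euler_gamma * mu - 4 * mu ^ 2)) as L.
  assert (Hgm : Rabs (euler_gamma * mu) <= / 2).
  { rewrite Rabs_mult, (Rabs_right euler_gamma) by lra. pose proof (Rabs_pos mu). nra. }
  pose proof (exp_le_quadratic _ Hgm) as U.
  pose proof (pow2_ge_0 mu).
  assert ((euler_gamma * mu) ^ 2 <= mu ^ 2) 
    by (rewrite Rpow_mult_distr; assert (euler_gamma ^ 2 <= 1) by nra; nra).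
  apply Rabs_le. lra.
Qed.

(** n! / ((mu+1) ... (mu+n)): the factor by which 1/Gamma(n+1+mu) differs from 1/(Gamma(1+mu)
    n!). *)
Fixpoint inv_rising (mu : R) (n : nat) : R :=
  match n with
  | O => 1
  | S k => inv_rising mu k * (INR (S k) / (INR (S k) + mu))
  end.

Lemma inv_rising_S (mu : R) (n : nat) :
  inv_rising mu (S n) = inv_rising mu n * (INR (S n) / (INR (S n) + mu)).
Proof. reflexivity. Qed.

Lemma INR_S_ge_1 (n : nat) : 1 <= INR (S n).
Proof. rewrite S_INR. pose proof (pos_INR n). lra. Qed.

Lemma inv_rising_0 (n : nat) : inv_rising 0 n = 1.
Proof.
  induction n as [|n IH]; [reflexivity|]. rewrite inv_rising_S, IH.
  pose proof (INR_S_ge_1 n). field. lra.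
Qed.

Lemma rGamma_inv_rising (mu : R) (n : nat) : -1 < mu ->
  rGamma (INR n + mu + 1) = rGamma (1 + mu) * inv_rising mu n / INR (fact n).
Proof.
  intros Hmu. induction n as [|n IH].
  - simpl. replace (0 + mu + 1) with (1 + mu) by ring. field.
  - pose proof (rGamma_shift (INR n + mu + 1)) as E. rewrite IH in E.
    rewrite inv_rising_S, INR_fact_S. pose proof (INR_fact_pos n).
    rewrite S_INR. pose proof (pos_INR n).
    replace (INR n + mu + 1 + 1) with (INR n + 1 + mu + 1) in E by ring.
    apply (Rmult_eq_reg_l (INR n + mu + 1)); [|lra].
    rewrite <- E. field. lra.
Qed.

(** For mu >= -1/2 a step at most doubles the error and adds 2 |mu|. The resulting 4^n is crude, but
    harmless against the factorials in the series. *)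
Lemma inv_rising_sub_one (mu : R) (n : nat) : Rabs mu <= / 2 ->
  Rabs (inv_rising mu n - 1) <= Rabs mu * (4 ^ n - 1).
Proof.
  intros Hmu. induction n as [|n IH].
  - simpl. rewrite !Rminus_diag, Rabs_R0. lra.
  - rewrite inv_rising_S. pose proof (INR_S_ge_1 n) as HN.
    set (N := INR (S n)) in *.
    assert (Hb : - / 2 <= mu <= / 2) by (apply Rabs_le_between; exact Hmu).
    replace (inv_rising mu n * (N / (N + mu)) - 1)
      with ((inv_rising mu n - 1) * (N / (N + mu)) + - (mu * / (N + mu)))
      by (field; lra).
    assert (Hq : 0 < / (N + mu) <= 2).
    { split; [apply Rinv_0_lt_compat; lra|].
      replace 2 with (/ / 2) by field. apply Rinv_le_contravar; lra. }
    assert (Hq2 : 0 < N / (N + mu) <= 2).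
    { split; [apply Rdiv_lt_0_compat; lra|].
      apply (proj2 (Rle_div_l _ _ _ (ltac:(lra) : 0 < N + mu))). lra. }
    eapply Rle_trans; [apply Rabs_triang|].
    rewrite Rabs_Ropp, !Rabs_mult, (Rabs_right (N / (N + mu))), (Rabs_right (/ (N + mu))) by lra.
    pose proof (Rabs_pos mu) as Hp. pose proof (Rabs_pos (inv_rising mu n - 1)).
    assert (H1 : Rabs (inv_rising mu n - 1) * (N / (N + mu)) <= Rabs mu * (4 ^ n - 1) * 2)
      by (apply Rmult_le_compat; lra).
    assert (H2 : Rabs mu * / (N + mu) <= Rabs mu * 2) by (apply Rmult_le_compat_l; lra).
    assert (H4 : 1 <= 4 ^ n) by (apply pow_R1_Rle; lra).
    simpl pow. nra.
Qed.

(** The remainder changes at step N = n + 1 by -(mu/N) ([inv_rising mu N] - 1), which the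
    first-order bound already makes quadratic in mu. *)
Lemma inv_rising_second_order (mu : R) (n : nat) : Rabs mu <= / 2 ->
  Rabs (inv_rising mu n - 1 + mu * harmonic n) <= 2 * mu ^ 2 * 4 ^ n.
Proof.
  intros Hmu. induction n as [|n IH].
  - simpl. rewrite Rminus_diag, Rmult_0_r, Rplus_0_l, Rabs_R0. nra.
  - pose proof (inv_rising_sub_one mu (S n) Hmu) as B.
    pose proof (INR_S_ge_1 n) as HN.
    assert (Hb : - / 2 <= mu <= / 2) by (apply Rabs_le_between; exact Hmu).
    replace (inv_rising mu (S n) - 1 + mu * harmonic (S n))
      with ((inv_rising mu n - 1 + mu * harmonic n)
            + - (mu * (/ INR (S n) * (inv_rising mu (S n) - 1)))).
    2: { rewrite harmonic_S, inv_rising_S. field. lra. }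
    eapply Rle_trans; [apply Rabs_triang|].
    rewrite Rabs_Ropp, !Rabs_mult.
    assert (Hi : 0 < / INR (S n) <= 1).
    { split; [apply Rinv_0_lt_compat; lra|]. rewrite <- Rinv_1.
      apply Rinv_le_contravar; lra. }
    rewrite (Rabs_right (/ INR (S n))) by lra.
    pose proof (Rabs_pos mu) as Hp.
    assert (H4 : 1 <= 4 ^ n) by (apply pow_R1_Rle; lra).
    assert (H1 : / INR (S n) * Rabs (inv_rising mu (S n) - 1) <= 1 * (Rabs mu * 4 ^ S n)).
    { apply Rmult_le_compat; [lra|apply Rabs_pos|lra|]. nra. }
    apply (Rmult_le_compat_l (Rabs mu)) in H1; [|exact Hp].
    assert (E : Rabs mu * Rabs mu = mu ^ 2) by (rewrite <- (pow2_abs mu); ring).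
    simpl pow in *. nra.
Qed.

Lemma pseries_exp_bound (a : nat -> R) (M z : R) : 0 <= z ->
  (forall n : nat, Rabs (a n) <= M * 4 ^ n / INR (fact n)) ->
  ex_pseries a z /\ Rabs (PSeries a z) <= M * exp (4 * z).
Proof.
  intros Hz Ha.
  assert (Hexp : is_series (fun n => M * (/ INR (fact n) * (4 * z) ^ n)) (M * exp (4 * z))).
  { apply (is_series_scal (V := R_NormedModule) M).
    apply is_pseries_R. apply is_exp_Reals. }
  assert (Hle : forall n, Rabs (a n * z ^ n) <= M * (/ INR (fact n) * (4 * z) ^ n)).
  { intros n. rewrite Rabs_mult, (Rabs_right (z ^ n)) by (apply Rle_ge, pow_le, Hz).
    rewrite Rpow_mult_distr.
    replace (M * (/ INR (fact n) * (4 ^ n * z ^ n)))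
      with (M * 4 ^ n / INR (fact n) * z ^ n) by (unfold Rdiv; ring).
    apply Rmult_le_compat_r; [now apply pow_le|apply Ha]. }
  assert (Habs : ex_series (fun n => Rabs (a n * z ^ n))).
  { apply (ex_series_le (V := R_CompleteNormedModule))
      with (fun n => M * (/ INR (fact n) * (4 * z) ^ n)); [|eexists; exact Hexp].
    intros n. unfold norm; simpl. unfold abs; simpl. rewrite Rabs_Rabsolu. apply Hle. }
  split.
  - apply ex_pseries_R. now apply ex_series_Rabs.
  - unfold PSeries. eapply Rle_trans; [now apply Series_Rabs|].
    rewrite <- (is_series_unique _ _ Hexp).
    apply Series_le; [|eexists; exact Hexp].
    intros n. split; [apply Rabs_pos|apply Hle].
Qed.

Lemma Rabs_div_fact2 (c M : R) (m n : nat) : Rabs c <= M ->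
  Rabs (c / (INR (fact m) * INR (fact n))) <= M / INR (fact n).
Proof.
  intros Hc. pose proof (INR_fact_pos m). pose proof (INR_fact_pos n).
  assert (1 <= INR (fact m)) by (apply (le_INR 1), lt_O_fact).
  pose proof (Rabs_pos c).
  rewrite Rabs_div by nra. rewrite (Rabs_right (INR (fact m) * INR (fact n))) by nra.
  apply Rmult_le_compat; [lra| |exact Hc|].
  - left. apply Rinv_0_lt_compat. nra.
  - apply Rinv_le_contravar; nra.
Qed.

(** Coefficients of P_(m+mu) divided by 1/Gamma(1+mu), so that the order enters the series only
    through rational functions of mu. *)
Definition rising_coef (m : nat) (mu : R) (n : nat) : R :=
  inv_rising mu (n + m) / (INR (fact (n + m)) * INR (fact n)).

Definition rising_series (m : nat) (mu z : R) : R := PSeries (rising_coef m mu) z.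

Lemma bessel_P_rising (m : nat) (mu z : R) : -1 < mu ->
  bessel_P (INR m + mu) z = rGamma (1 + mu) * rising_series m mu z.
Proof.
  intros Hmu. unfold bessel_P, rising_series. rewrite <- PSeries_scal.
  apply PSeries_ext. intros n. change (bessel_coef (INR m + mu) n = rGamma (1 + mu) * rising_coef m mu n).
  unfold bessel_coef, rising_coef.
  replace (INR n + (INR m + mu) + 1) with (INR (n + m) + mu + 1) by (rewrite plus_INR; ring).
  rewrite rGamma_inv_rising by exact Hmu.
  pose proof (INR_fact_pos (n + m)). pose proof (INR_fact_pos n). field. lra.
Qed.

Lemma ex_pseries_rising (m : nat) (mu z : R) : 0 <= z -> Rabs mu <= / 2 ->
  ex_pseries (rising_coef m mu) z.
Proof.
  intros Hz Hmu.
  apply (pseries_exp_bound _ (4 ^ m) z Hz). intros n.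
  apply Rabs_div_fact2.
  pose proof (inv_rising_sub_one mu (n + m) Hmu) as B.
  assert (H4 : 1 <= 4 ^ (n + m)) by (apply pow_R1_Rle; lra).
  replace (inv_rising mu (n + m)) with ((inv_rising mu (n + m) - 1) + 1) by ring.
  eapply Rle_trans; [apply Rabs_triang|]. rewrite Rabs_R1.
  rewrite pow_add in *. nra.
Qed.

Lemma rising_series_lipschitz (m : nat) (mu z : R) : 0 <= z -> Rabs mu <= / 2 ->
  Rabs (rising_series m mu z - rising_series m 0 z) <= Rabs mu * 4 ^ m * exp (4 * z).
Proof.
  intros Hz Hmu. unfold rising_series.
  assert (H0 : Rabs 0 <= / 2) by (rewrite Rabs_R0; lra).
  rewrite <- (PSeries_minus _ _ _ (ex_pseries_rising m mu z Hz Hmu)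
                (ex_pseries_rising m 0 z Hz H0)).
  apply (pseries_exp_bound _ _ z Hz). intros n.
  change (PS_minus (rising_coef m mu) (rising_coef m 0) n)
    with (rising_coef m mu n - rising_coef m 0 n).
  unfold rising_coef. rewrite inv_rising_0.
  replace (inv_rising mu (n + m) / (INR (fact (n + m)) * INR (fact n))
           - 1 / (INR (fact (n + m)) * INR (fact n)))
    with ((inv_rising mu (n + m) - 1) / (INR (fact (n + m)) * INR (fact n)))
    by (unfold Rdiv; ring).
  apply Rabs_div_fact2.
  eapply Rle_trans; [now apply inv_rising_sub_one|].
  rewrite pow_add. pose proof (Rabs_pos mu). nra.
Qed.

Definition harmonic_coef (n : nat) : R := harmonic n / (INR (fact n) * INR (fact n)).

Definition harmonic_series (z : R) : R := PSeries harmonic_coef z.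

Lemma harmonic_bounds (n : nat) : 0 <= harmonic n <= 4 ^ n.
Proof.
  induction n as [|n IH]; [simpl; lra|].
  rewrite harmonic_S. pose proof (INR_S_ge_1 n).
  assert (Hi : 0 < / INR (S n) <= 1).
  { split; [apply Rinv_0_lt_compat; lra|]. rewrite <- Rinv_1.
    apply Rinv_le_contravar; lra. }
  assert (H4 : 1 <= 4 ^ n) by (apply pow_R1_Rle; lra). simpl pow. lra.
Qed.

Lemma harmonic_coef_bound (n : nat) : Rabs (harmonic_coef n) <= 1 * 4 ^ n / INR (fact n).
Proof.
  apply Rabs_div_fact2. rewrite Rabs_right; [|apply Rle_ge]; pose proof (harmonic_bounds n); lra.
Qed.

Lemma ex_pseries_harmonic (z : R) : 0 <= z -> ex_pseries harmonic_coef z.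
Proof. intros Hz. apply (pseries_exp_bound _ 1 z Hz), harmonic_coef_bound. Qed.

Lemma is_derive_rising_series (z : R) : 0 <= z ->
  is_derive (fun mu => rising_series 0 mu z) 0 (- harmonic_series z).
Proof.
  intros Hz. apply (is_derive_quadratic _ _ (2 * exp (4 * z))). intros mu Hmu.
  assert (H0 : Rabs 0 <= / 2) by (rewrite Rabs_R0; lra).
  replace (rising_series 0 mu z - rising_series 0 0 z - - harmonic_series z * mu)
    with (rising_series 0 mu z - rising_series 0 0 z + mu * harmonic_series z) by ring.
  unfold rising_series, harmonic_series.
  pose proof (ex_pseries_rising 0 mu z Hz Hmu) as X1.
  pose proof (ex_pseries_rising 0 0 z Hz H0) as X2.
  pose proof (ex_pseries_harmonic z Hz) as X3.
  assert (X4 : ex_pseries (PS_scal mu harmonic_coef) z)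
    by (apply ex_pseries_scal; [apply Rmult_comm|exact X3]).
  pose proof (ex_pseries_minus _ _ _ X1 X2) as X5.
  rewrite <- (PSeries_minus _ _ _ X1 X2), <- PSeries_scal, <- (PSeries_plus _ _ _ X5 X4).
  replace (2 * exp (4 * z) * mu ^ 2) with (2 * mu ^ 2 * exp (4 * z)) by ring.
  apply (pseries_exp_bound _ _ z Hz). intros n.
  change (PS_plus (PS_minus (rising_coef 0 mu) (rising_coef 0 0)) (PS_scal mu harmonic_coef) n)
    with (rising_coef 0 mu n - rising_coef 0 0 n + mu * harmonic_coef n).
  unfold rising_coef, harmonic_coef. rewrite Nat.add_0_r, inv_rising_0.
  replace (inv_rising mu n / (INR (fact n) * INR (fact n)) - 1 / (INR (fact n) * INR (fact n))
           + mu * (harmonic n / (INR (fact n) * INR (fact n))))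
    with ((inv_rising mu n - 1 + mu * harmonic n) / (INR (fact n) * INR (fact n)))
    by (unfold Rdiv; ring).
  apply Rabs_div_fact2. now apply inv_rising_second_order.
Qed.

Lemma locally_0_half : locally 0 (fun mu : R => Rabs mu <= / 2).
Proof.
  exists (mkposreal (/ 2) ltac:(lra)). intros mu Hmu.
  unfold ball in Hmu; simpl in Hmu.
  unfold AbsRing_ball, abs, minus, plus, opp in Hmu; simpl in Hmu.
  rewrite Ropp_0, Rplus_0_r in Hmu. lra.
Qed.

Lemma is_derive_bessel_I_order (x : R) : 0 < x ->
  is_derive (fun mu => bessel_I mu x) 0
    ((ln (x / 2) + euler_gamma) * bessel_I 0 x - harmonic_series ((x / 2) ^ 2)).
Proof.
  intros Hx. set (z := (x / 2) ^ 2).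
  assert (Hz : 0 <= z) by apply pow2_ge_0.
  assert (HI : forall mu, Rabs mu <= / 2 ->
    bessel_I mu x = Rpower (x / 2) mu * (rGamma (1 + mu) * rising_series 0 mu z)).
  { intros mu Hmu. apply Rabs_le_between in Hmu.
    rewrite bessel_I_eq, <- bessel_P_rising by lra. simpl INR.
    now rewrite Rplus_0_l. }
  apply is_derive_ext_loc with
    (fun mu => Rpower (x / 2) mu * (rGamma (1 + mu) * rising_series 0 mu z)).
  { generalize locally_0_half. apply filter_imp. intros mu Hmu. now rewrite HI. }
  assert (H0 : Rabs 0 <= / 2) by (rewrite Rabs_R0; lra).
  rewrite (HI 0 H0).
  assert (E0 : Rpower (x / 2) 0 = 1) by (apply Rpower_O; lra).
  replace ((ln (x / 2) + euler_gamma) * (Rpower (x / 2) 0 * (rGamma (1 + 0) * rising_series 0 0 z))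
           - harmonic_series z)
    with (ln (x / 2) * (rGamma (1 + 0) * rising_series 0 0 z)
          + Rpower (x / 2) 0 * (euler_gamma * rising_series 0 0 z
                                + rGamma (1 + 0) * - harmonic_series z))
    by (rewrite E0, Rplus_0_r, rGamma_1; ring).
  apply (is_derive_mult (fun mu => Rpower (x / 2) mu)
           (fun mu => rGamma (1 + mu) * rising_series 0 mu z) 0); [| |apply Rmult_comm].
  - unfold Rpower. auto_derive; [trivial|]. rewrite Rmult_0_l, exp_0. ring.
  - apply (is_derive_mult (fun mu => rGamma (1 + mu)) (fun mu => rising_series 0 mu z) 0);
      [apply is_derive_rGamma_one|now apply is_derive_rising_series|apply Rmult_comm].
Qed.

Lemma continuous_rising_series (m : nat) (z : R) : 0 <= z ->
  continuous (fun mu => rising_series m mu z) 0.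
Proof.
  intros Hz. apply filterlim_locally. intros eps.
  set (C := 4 ^ m * exp (4 * z)).
  assert (HC : 0 < C) by (apply Rmult_lt_0_compat; [apply pow_lt; lra|apply exp_pos]).
  assert (Hd : 0 < Rmin (/ 2) (eps / C)).
  { apply Rmin_pos; [lra|]. apply Rdiv_lt_0_compat; [apply cond_pos|exact HC]. }
  exists (mkposreal _ Hd). intros mu Hmu.
  change (Rabs (mu - 0) < Rmin (/ 2) (eps / C)) in Hmu. rewrite Rminus_0_r in Hmu.
  pose proof (Rmin_l (/ 2) (eps / C)). pose proof (Rmin_r (/ 2) (eps / C)).
  change (Rabs (rising_series m mu z - rising_series m 0 z) < eps).
  eapply Rle_lt_trans; [apply rising_series_lipschitz; lra|].
  rewrite Rmult_assoc. fold C. apply (proj2 (Rlt_div_r _ _ _ HC)). lra.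
Qed.

Lemma continuous_bessel_I_order (m : nat) (x : R) : 0 < x ->
  continuous (fun nu => bessel_I nu x) (INR m).
Proof.
  intros Hx.
  assert (H : continuous (fun mu => bessel_I (INR m + mu) x) 0).
  { apply continuous_ext_loc with (fun mu => Rpower (x / 2) (INR m + mu) *
      (rGamma (1 + mu) * rising_series m mu ((x / 2) ^ 2))).
    - generalize locally_0_half. apply filter_imp. intros mu Hmu.
      apply Rabs_le_between in Hmu.
      rewrite bessel_I_eq, bessel_P_rising by lra. reflexivity.
    - apply (continuous_mult (K := R_AbsRing)).
      + apply (ex_derive_continuous (K := R_AbsRing) (V := R_NormedModule)).
        unfold Rpower. auto_derive. trivial.
      + apply (continuous_mult (K := R_AbsRing)).
        * apply (ex_derive_continuous (K := R_AbsRing) (V := R_NormedModule)).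
          eexists. apply is_derive_rGamma_one.
        * apply continuous_rising_series, pow2_ge_0. }
  apply continuous_ext with (fun nu => bessel_I (INR m + (nu - INR m)) x).
  { intros nu. f_equal. ring. }
  apply (continuous_comp (fun nu => nu - INR m) (fun mu => bessel_I (INR m + mu) x)).
  - apply (ex_derive_continuous (K := R_AbsRing) (V := R_NormedModule)). auto_derive. trivial.
  - now rewrite Rminus_diag.
Qed.

Lemma is_lim_bessel_I_order (m : nat) (x : R) : 0 < x ->
  is_lim (fun nu => bessel_I nu x) (INR m) (bessel_I (INR m) x).
Proof.
  intros Hx. apply (is_lim_continuity (fun nu => bessel_I nu x)).
  apply continuity_pt_filterlim, continuous_bessel_I_order, Hx.
Qed.

(** * K at integer order as a limit *)

Lemma is_lim_slope (f : R -> R) (l : R) :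
  is_derive f 0 l -> is_lim (fun h => (f h - f 0) / h) 0 l.
Proof.
  intros H. apply is_derive_Reals in H. apply is_lim_spec. intros eps.
  destruct (H eps (cond_pos eps)) as [d Hd].
  exists d. intros h Hh Hh0.
  change (Rabs (h - 0) < d) in Hh. rewrite Rminus_0_r in Hh.
  specialize (Hd h Hh0 Hh). now rewrite Rplus_0_l in Hd.
Qed.

Lemma sin_mul_PI_neq_0 (n : nat) (mu : R) :
  mu <> INR n -> Rabs (mu - INR n) < 1 -> sin (mu * PI) <> 0.
Proof.
  intros Hne Hlt Hs. pose proof PI_RGT_0.
  destruct (sin_eq_0_0 _ Hs) as [k Hk].
  apply Rmult_eq_reg_r in Hk; [|lra].
  rewrite INR_IZR_INZ in *. subst mu.
  rewrite <- minus_IZR, <- abs_IZR in Hlt. apply lt_IZR in Hlt.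
  apply Hne. f_equal. lia.
Qed.

Lemma locally'_noninteger (n : nat) :
  locally' (INR n) (fun mu : R => sin (mu * PI) <> 0).
Proof.
  exists (mkposreal 1 Rlt_0_1). intros mu Hmu Hne.
  exact (sin_mul_PI_neq_0 n mu Hne Hmu).
Qed.

Definition bessel_K0 (x : R) : R :=
  harmonic_series ((x / 2) ^ 2) - (ln (x / 2) + euler_gamma) * bessel_I 0 x.

Lemma is_lim_bessel_K_quotient_0 (x : R) : 0 < x ->
  is_lim (fun mu => bessel_K_quotient mu x) 0 (bessel_K0 x).
Proof.
  intros Hx. pose proof PI_RGT_0 as HPI.
  pose proof (is_derive_bessel_I_order x Hx) as D.
  set (l := (ln (x / 2) + euler_gamma) * bessel_I 0 x - harmonic_series ((x / 2) ^ 2)) in D.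
  assert (D1 : is_derive (fun mu => bessel_I (- mu) x - bessel_I mu x) 0 (- 2 * l)).
  { replace (- 2 * l) with (-1 * l - l) by ring.
    apply (is_derive_minus (V := R_NormedModule)); [|exact D].
    apply (is_derive_comp (fun mu => bessel_I mu x) (fun mu => - mu) 0 l (-1)).
    - now rewrite Ropp_0.
    - auto_derive; [trivial|ring]. }
  assert (D2 : is_derive (fun mu => sin (mu * PI)) 0 PI).
  { auto_derive; [trivial|]. rewrite Rmult_0_l, cos_0. ring. }
  apply is_lim_slope in D1. apply is_lim_slope in D2.
  assert (L : is_lim (fun mu => PI / 2 * (((bessel_I (- mu) x - bessel_I mu x
       - (bessel_I (- 0) x - bessel_I 0 x)) / mu) / ((sin (mu * PI) - sin (0 * PI)) / mu)))
       0 (Rbar_mult (PI / 2) (Rbar_div (- 2 * l) PI))).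
  { apply (is_lim_scal_l _ (PI / 2)).
    apply is_lim_div; [exact D1|exact D2| |].
    - intros E. injection E. lra.
    - unfold ex_Rbar_div. simpl. exact I. }
  simpl in L.
  replace (PI / 2 * (- 2 * l * / PI)) with (bessel_K0 x) in L
    by (unfold l, bessel_K0; field; lra).
  apply is_lim_ext_loc with (2 := L).
  destruct (locally'_noninteger 0) as [d Hd]. simpl INR in Hd.
  exists d. intros mu Hmu Hne. specialize (Hd mu Hmu Hne).
  unfold bessel_K_quotient. rewrite Ropp_0, Rmult_0_l, sin_0. field. split; assumption.
Qed.

(** [bessel_K] at an integer is the value of a total operator, so nothing can be inferred from it
    until the limit is known to exist and to be finite. The function f below is the cross relation
    solved for K of order mu + 1. *)
Lemma ex_lim_bessel_K_quotient (n : nat) (x : R) : 0 < x ->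
  exists l : R, is_lim (fun mu => bessel_K_quotient mu x) (INR n) l.
Proof.
  intros Hx. induction n as [|n [l IH]].
  - exists (bessel_K0 x). now apply is_lim_bessel_K_quotient_0.
  - pose proof (is_lim_bessel_I_order n x Hx) as L0.
    pose proof (is_lim_bessel_I_order (S n) x Hx) as L1.
    pose proof (bessel_I_pos (INR n) x ltac:(pose proof (pos_INR n); lra) Hx) as Hp.
    set (f := fun mu => (/ x - bessel_I (mu + 1) x * bessel_K_quotient mu x) / bessel_I mu x).
    assert (L1' : is_lim (fun mu => bessel_I (mu + 1) x) (INR n) (bessel_I (INR (S n)) x)).
    { apply is_lim_ext with (fun mu => bessel_I (1 * mu + 1) x).
      { intros mu. now rewrite Rmult_1_l. }
      apply (is_lim_comp_lin (fun nu => bessel_I nu x) 1 1); [|lra].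
      simpl Rbar_plus. rewrite Rmult_1_l, <- S_INR. exact L1. }
    assert (Lf : is_lim f (INR n)
       ((/ x - bessel_I (INR (S n)) x * l) / bessel_I (INR n) x)).
    { apply (is_lim_div (fun mu => / x - bessel_I (mu + 1) x * bessel_K_quotient mu x)
               (fun mu => bessel_I mu x) _ (/ x - bessel_I (INR (S n)) x * l) (bessel_I (INR n) x)).
      - apply (is_lim_minus _ _ _ (/ x) (bessel_I (INR (S n)) x * l)).
        + apply is_lim_const.
        + apply (is_lim_mult _ _ _ (bessel_I (INR (S n)) x) l); [exact L1'|exact IH|exact I].
        + reflexivity.
      - exact L0.
      - intros E. injection E. lra.
      - exact I. }
    eexists.
    apply is_lim_ext_loc with (fun nu => f (1 * nu + -1)).
    + destruct (locally'_noninteger (S n)) as [d Hd].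
      (* The radius 1/2 keeps mu = nu - 1 above -1, so that I_mu is positive and can be divided
         by. *)
      assert (Hd' : 0 < Rmin d (/ 2)) by (apply Rmin_pos; [apply cond_pos|lra]).
      exists (mkposreal _ Hd'). intros nu Hnu Hne.
      change (Rabs (nu - INR (S n)) < Rmin d (/ 2)) in Hnu.
      pose proof (Rmin_l d (/ 2)). pose proof (Rmin_r d (/ 2)).
      assert (Hs : sin (nu * PI) <> 0).
      { apply Hd; [|exact Hne]. change (Rabs (nu - INR (S n)) < d). lra. }
      set (mu := 1 * nu + -1). replace nu with (mu + 1) in * by (unfold mu; ring).
      rewrite sin_succ_PI in Hs.
      assert (Hmu : -1 < mu).
      { rewrite S_INR in Hnu. pose proof (pos_INR n).
        assert (Hnu' : Rabs (mu + 1 - (INR n + 1)) < / 2) by lra.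
        apply Rabs_def2 in Hnu'. lra. }
      pose proof (bessel_I_pos mu x Hmu Hx).
      pose proof (bessel_IK_cross mu x Hx ltac:(lra)) as W.
      unfold f. rewrite <- W. field. lra.
    + apply (is_lim_comp_lin f 1 (-1)); [|lra].
      change (Rbar_plus (Rbar_mult 1 (INR (S n))) (-1)) with (Finite (1 * INR (S n) + -1)).
      replace (1 * INR (S n) + -1) with (INR n) by (rewrite S_INR; ring).
      exact Lf.
Qed.

Lemma bessel_K_noninteger (nu x : R) : sin (nu * PI) <> 0 ->
  bessel_K nu x = bessel_K_quotient nu x.
Proof. intros H. unfold bessel_K. now destruct (Req_dec_T (sin (nu * PI)) 0). Qed.

Lemma sin_INR_PI (n : nat) : sin (INR n * PI) = 0.
Proof.
  induction n as [|n IH]; [simpl; rewrite Rmult_0_l; apply sin_0|].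
  rewrite S_INR, sin_succ_PI, IH. ring.
Qed.

Lemma is_lim_bessel_K (n : nat) (x : R) : 0 < x ->
  is_lim (fun mu => bessel_K_quotient mu x) (INR n) (bessel_K (INR n) x).
Proof.
  intros Hx. destruct (ex_lim_bessel_K_quotient n x Hx) as [l Hl].
  unfold bessel_K. destruct (Req_dec_T (sin (INR n * PI)) 0) as [_|H].
  - rewrite (is_lim_unique _ _ _ Hl). exact Hl.
  - destruct (H (sin_INR_PI n)).
Qed.

Lemma bessel_K_0 (x : R) : 0 < x -> bessel_K 0 x = bessel_K0 x.
Proof.
  intros Hx. pose proof (is_lim_unique _ _ _ (is_lim_bessel_K 0 x Hx)) as E.
  change (INR 0) with 0 in E.
  rewrite (is_lim_unique _ _ _ (is_lim_bessel_K_quotient_0 x Hx)) in E.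
  now injection E.
Qed.

(** * Monotonicity for every order *)

Lemma bessel_IK_ln_increase_all (nu x y : R) : 0 <= nu -> 0 < x -> x < y ->
  (bessel_I nu y ^ 2 - bessel_I nu x ^ 2) / (2 * bessel_I nu (2 * y) ^ 2)
  <= bessel_I nu y * bessel_K nu y + ln y - (bessel_I nu x * bessel_K nu x + ln x).
Proof.
  intros Hnu Hx Hxy. pose proof PI_RGT_0 as HPI.
  destruct (Req_dec_T (sin (nu * PI)) 0) as [Hs|Hs].
  - assert (Hn : exists n : nat, nu = INR n).
    { destruct (sin_eq_0_0 _ Hs) as [k Hk]. apply Rmult_eq_reg_r in Hk; [|lra].
      exists (Z.to_nat k). rewrite INR_IZR_INZ, Z2Nat.id; [exact Hk|].
      apply le_IZR. now rewrite <- Hk. }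
    destruct Hn as [n ->].
    (* The orders approach n from above with offset in (0, 1): non-integer, and positive even when n
       = 0. *)
    set (u := fun k : nat => INR n + / INR (S (S k))).
    assert (Hu : forall k, 0 < u k - INR n < 1).
    { intros k. unfold u. pose proof (INR_S_ge_1 k).
      rewrite (S_INR (S k)). replace (INR n + / (INR (S k) + 1) - INR n) with (/ (INR (S k) + 1)) by ring.
      split; [apply Rinv_0_lt_compat; lra|]. rewrite <- Rinv_1 at 2.
      apply Rinv_lt_contravar; lra. }
    assert (Lu : is_lim_seq u (INR n)).
    { replace (Finite (INR n)) with (Finite (INR n + 0)) by (f_equal; ring).
      apply is_lim_seq_plus'; [apply is_lim_seq_const|].
      apply (is_lim_seq_incr_1 (fun k => / INR (S k))). exact is_lim_seq_inv_S. }
    assert (Hseq : forall f l, is_lim f (INR n) (Finite l) -> is_lim_seq (fun k => f (u k)) l).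
    { intros f l Hf. apply (is_lim_comp_seq f u (INR n) l Hf); [|exact Lu].
      exists 0%nat. intros k _ E. injection E. specialize (Hu k). lra. }
    pose proof (fun t Ht => Hseq _ _ (is_lim_bessel_I_order n t Ht)) as LI.
    pose proof (fun t Ht => Hseq _ _ (is_lim_bessel_K n t Ht)) as LK.
    pose proof (bessel_I_pos (INR n) (2 * y) ltac:(lra) ltac:(lra)) as P2.
    assert (Hsq : forall t, 0 < t ->
      is_lim_seq (fun k => bessel_I (u k) t ^ 2) (bessel_I (INR n) t ^ 2)).
    { intros t Ht. specialize (LI t Ht).
      apply is_lim_seq_ext with (fun k => bessel_I (u k) t * bessel_I (u k) t); [intros; ring|].
      replace (bessel_I (INR n) t ^ 2) with (bessel_I (INR n) t * bessel_I (INR n) t) by ring.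
      now apply is_lim_seq_mult'. }
    assert (Hside : forall t, 0 < t ->
      is_lim_seq (fun k => bessel_I (u k) t * bessel_K_quotient (u k) t + ln t)
                 (bessel_I (INR n) t * bessel_K (INR n) t + ln t)).
    { intros t Ht. apply is_lim_seq_plus'; [|apply is_lim_seq_const].
      apply is_lim_seq_mult'; [now apply LI|now apply LK]. }
    assert (LL : is_lim_seq (fun k =>
      (bessel_I (u k) y ^ 2 - bessel_I (u k) x ^ 2) / (2 * bessel_I (u k) (2 * y) ^ 2))
      ((bessel_I (INR n) y ^ 2 - bessel_I (INR n) x ^ 2) / (2 * bessel_I (INR n) (2 * y) ^ 2))).
    { apply is_lim_seq_div'; [apply is_lim_seq_minus'; apply Hsq; lra| |nra].
      apply is_lim_seq_mult'; [apply is_lim_seq_const|apply Hsq; lra]. }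
    refine (is_lim_seq_le _ _ _ _ _ LL
      (is_lim_seq_minus' _ _ _ _ (Hside y ltac:(lra)) (Hside x Hx))).
    intros k. specialize (Hu k).
    apply bessel_IK_ln_increase; try assumption; [lra|].
    apply (sin_mul_PI_neq_0 n); [lra|]. rewrite Rabs_right; lra.
  - rewrite !bessel_K_noninteger by exact Hs.
    apply bessel_IK_ln_increase; try assumption.
    destruct Hnu as [H|<-]; [exact H|]. destruct Hs. rewrite Rmult_0_l. apply sin_0.
Qed.

(** Strictness, lost in the limit, is recovered because the lower bound for the increase is
    positive: I_nu is positive and strictly increasing. *)
Lemma bessel_IK_ln_lt (nu x y : R) : 0 <= nu -> 0 < x -> x < y ->
  bessel_I nu x * bessel_K nu x + ln x < bessel_I nu y * bessel_K nu y + ln y.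
Proof.
  intros Hnu Hx Hxy.
  pose proof (bessel_IK_ln_increase_all nu x y Hnu Hx Hxy) as H.
  pose proof (bessel_I_pos nu x ltac:(lra) Hx).
  pose proof (bessel_I_pos nu (2 * y) ltac:(lra) ltac:(lra)).
  pose proof (bessel_I_lt nu x y Hnu Hx Hxy).
  assert (0 < (bessel_I nu y ^ 2 - bessel_I nu x ^ 2) / (2 * bessel_I nu (2 * y) ^ 2))
    by (apply Rdiv_lt_0_compat; nra).
  lra.
Qed.

(** * Order zero: numerical bounds *)

Lemma nonneg_of_derive_nonneg (f df : R -> R) (b : R) : 0 <= b ->
  (forall t, 0 <= t <= b -> is_derive f t (df t)) ->
  (forall t, 0 <= t <= b -> 0 <= df t) -> f 0 = 0 -> 0 <= f b.
Proof.
  intros Hb Hd Hp H0.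
  destruct (MVT_gen f 0 b df) as [c [Hc E]].
  - intros t Ht. rewrite Rmin_left, Rmax_right in Ht by lra. apply Hd; lra.
  - intros t Ht. rewrite Rmin_left, Rmax_right in Ht by lra.
    apply derivable_continuous_pt, ex_derive_Reals_0. eexists. apply Hd; lra.
  - rewrite Rmin_left, Rmax_right in Hc by lra.
    specialize (Hp c Hc). rewrite H0 in E. nra.
Qed.

(** At u = 1/(2N+1) the two rational terms are the trapezoidal value (1/N + 1/(N+1))/2 and the
    correction (1/N^2 - 1/(N+1)^2)/12, so the bound telescopes in N. *)
Lemma ln_ratio_lower (u : R) : 0 <= u < 1 ->
  2 * u / (1 - u ^ 2) - 4 / 3 * u ^ 3 / (1 - u ^ 2) ^ 2 <= ln (1 + u) - ln (1 - u).
Proof.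
  intros Hu. apply Rminus_le_0.
  apply (nonneg_of_derive_nonneg
    (fun u => ln (1 + u) - ln (1 - u) - (2 * u / (1 - u ^ 2) - 4 / 3 * u ^ 3 / (1 - u ^ 2) ^ 2))
    (fun u => 16 / 3 * u ^ 4 / (1 - u ^ 2) ^ 3)); [lra| | |].
  - intros t Ht. assert (0 < 1 - t * (t * 1)) by nra.
    auto_derive.
    + repeat split; simpl; try lra. nra.
    + field. simpl. repeat split; nra.
  - intros t Ht. assert (0 < 1 - t ^ 2) by nra.
    apply Rdiv_le_0_compat; [|now apply pow_lt].
    pose proof (pow_le t 4 ltac:(lra)). lra.
  - rewrite Rplus_0_r, Rminus_0_r, ln_1. field.
Qed.

(** The additional term is the next correction: at u = 1/(2N+1) it equals (1/N^4 -
    1/(N+1)^4)/120. *)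
Lemma ln_ratio_upper (u : R) : 0 <= u < 1 ->
  ln (1 + u) - ln (1 - u) <=
  2 * u / (1 - u ^ 2) - 4 / 3 * u ^ 3 / (1 - u ^ 2) ^ 2
  + 16 / 15 * u ^ 5 * (1 + u ^ 2) / (1 - u ^ 2) ^ 4.
Proof.
  intros Hu. apply Rminus_le_0.
  apply (nonneg_of_derive_nonneg
    (fun u => 2 * u / (1 - u ^ 2) - 4 / 3 * u ^ 3 / (1 - u ^ 2) ^ 2
       + 16 / 15 * u ^ 5 * (1 + u ^ 2) / (1 - u ^ 2) ^ 4 - (ln (1 + u) - ln (1 - u)))
    (fun u => 16 / 15 * u ^ 4 * (20 * u ^ 2 - 4 * u ^ 4) / (1 - u ^ 2) ^ 5)); [lra| | |].
  - intros t Ht. assert (0 < 1 - t * (t * 1)) by nra.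
    auto_derive.
    + assert (0 < (1 - t * (t * 1)) * (1 - t * (t * 1))) by nra.
      repeat split; simpl; try lra; nra.
    + field. simpl. repeat split; nra.
  - intros t Ht. assert (0 < 1 - t ^ 2) by nra.
    apply Rdiv_le_0_compat; [|now apply pow_lt].
    pose proof (pow_le t 4 ltac:(lra)).
    apply Rmult_le_pos; [lra|].
    replace (20 * t ^ 2 - 4 * t ^ 4) with (t ^ 2 * (20 - 4 * t ^ 2)) by ring.
    apply Rmult_le_pos; nra.
  - rewrite Rplus_0_r, Rminus_0_r, ln_1. field.
Qed.

(* Euler-Maclaurin corrections of [H_n - ln n]; with [u = 1/(2n+1)] the two
   estimates above say that the first is decreasing and the second increasing. *)
Definition gamma_upper (n : nat) : R :=
  harmonic n - ln (INR n) - / (2 * INR n) + / (12 * INR n ^ 2).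

Definition gamma_lower (n : nat) : R := gamma_upper n - / (120 * INR n ^ 4).

Lemma ln_succ_ratio (N : R) : 0 < N ->
  ln (N + 1) - ln N = ln (1 + / (2 * N + 1)) - ln (1 - / (2 * N + 1)).
Proof.
  intros HN.
  replace (1 + / (2 * N + 1)) with ((N + 1) * (2 / (2 * N + 1))) by (field; lra).
  replace (1 - / (2 * N + 1)) with (N * (2 / (2 * N + 1))) by (field; lra).
  assert (0 < 2 / (2 * N + 1)) by (apply Rdiv_lt_0_compat; lra).
  rewrite !ln_mult by lra. ring.
Qed.

Lemma inv_odd_bounds (N : R) : 0 < N -> 0 <= / (2 * N + 1) < 1.
Proof.
  intros HN. split; [left; apply Rinv_0_lt_compat; lra|].
  rewrite <- Rinv_1. apply Rinv_lt_contravar; lra.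
Qed.

Lemma gamma_upper_decr (n : nat) : gamma_upper (S (S n)) <= gamma_upper (S n).
Proof.
  unfold gamma_upper. rewrite (harmonic_S (S n)), (S_INR (S n)).
  pose proof (INR_S_ge_1 n) as HN. set (N := INR (S n)) in *.
  pose proof (ln_succ_ratio N ltac:(lra)) as E.
  pose proof (ln_ratio_lower _ (inv_odd_bounds N ltac:(lra))) as L.
  rewrite <- E in L. clear E.
  replace (2 * / (2 * N + 1) / (1 - (/ (2 * N + 1)) ^ 2) -
     4 / 3 * (/ (2 * N + 1)) ^ 3 / (1 - (/ (2 * N + 1)) ^ 2) ^ 2)
    with (/ (N + 1) - / (2 * (N + 1)) + / (12 * (N + 1) ^ 2) + / (2 * N) - / (12 * N ^ 2)) in L.
  - lra.
  - field. repeat split; nra.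
Qed.

Lemma gamma_lower_incr (n : nat) : gamma_lower (S n) <= gamma_lower (S (S n)).
Proof.
  unfold gamma_lower, gamma_upper. rewrite (harmonic_S (S n)), (S_INR (S n)).
  pose proof (INR_S_ge_1 n) as HN. set (N := INR (S n)) in *.
  pose proof (ln_succ_ratio N ltac:(lra)) as E.
  pose proof (ln_ratio_upper _ (inv_odd_bounds N ltac:(lra))) as L.
  rewrite <- E in L. clear E.
  replace (2 * / (2 * N + 1) / (1 - (/ (2 * N + 1)) ^ 2) -
     4 / 3 * (/ (2 * N + 1)) ^ 3 / (1 - (/ (2 * N + 1)) ^ 2) ^ 2 +
     16 / 15 * (/ (2 * N + 1)) ^ 5 * (1 + (/ (2 * N + 1)) ^ 2) / (1 - (/ (2 * N + 1)) ^ 2) ^ 4)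
    with (/ (N + 1) - / (2 * (N + 1)) + / (12 * (N + 1) ^ 2) + / (2 * N) - / (12 * N ^ 2)
          - / (120 * (N + 1) ^ 4) + / (120 * N ^ 4)) in L.
  - lra.
  - field. repeat split; nra.
Qed.

Lemma is_lim_gamma_upper : is_lim_seq (fun n : nat => gamma_upper (S n)) euler_gamma.
Proof.
  pose proof is_lim_seq_inv_S as L.
  apply is_lim_seq_ext with (fun n : nat => harmonic (S n) - ln (INR (S n))
     + (- / 2 * / INR (S n) + / 12 * (/ INR (S n) * / INR (S n)))).
  { intros n. unfold gamma_upper. pose proof (INR_S_ge_1 n). field. lra. }
  replace (Finite euler_gamma) with (Finite (euler_gamma + (- / 2 * 0 + / 12 * (0 * 0))))
    by (f_equal; ring).
  repeat first [apply is_lim_seq_plus' | apply is_lim_seq_mult' | exact is_lim_euler_gamma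
               | exact L | apply is_lim_seq_const].
Qed.

Lemma is_lim_gamma_lower : is_lim_seq (fun n : nat => gamma_lower (S n)) euler_gamma.
Proof.
  pose proof is_lim_seq_inv_S as L.
  apply is_lim_seq_ext with (fun n : nat => gamma_upper (S n)
     + - / 120 * (/ INR (S n) * (/ INR (S n) * (/ INR (S n) * / INR (S n))))).
  { intros n. unfold gamma_lower. pose proof (INR_S_ge_1 n). field. lra. }
  replace (Finite euler_gamma) with (Finite (euler_gamma + - / 120 * (0 * (0 * (0 * 0)))))
    by (f_equal; ring).
  repeat first [exact is_lim_gamma_upper | apply is_lim_seq_plus' | apply is_lim_seq_mult'
               | exact L | apply is_lim_seq_const].
Qed.

Lemma euler_gamma_between (n : nat) : gamma_lower (S n) <= euler_gamma <= gamma_upper (S n).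
Proof.
  split.
  - exact (is_lim_seq_incr_compare _ _ is_lim_gamma_lower gamma_lower_incr n).
  - exact (is_lim_seq_decr_compare _ _ is_lim_gamma_upper gamma_upper_decr n).
Qed.

(** ln 2 = 2 artanh (1/3), with nine terms of the Taylor series. *)
Lemma ln_2_bounds : 6931471804 / 10 ^ 10 <= ln 2 <= 6931471807 / 10 ^ 10.
Proof.
  set (p := fun u : R => 2 * (u + u ^ 3 / 3 + u ^ 5 / 5 + u ^ 7 / 7 + u ^ 9 / 9 + u ^ 11 / 11
              + u ^ 13 / 13 + u ^ 15 / 15 + u ^ 17 / 17)).
  assert (Hln : ln (1 + / 3) - ln (1 - / 3) = ln 2).
  { rewrite <- ln_div by lra. f_equal. field. }
  assert (HL : 0 <= ln (1 + / 3) - ln (1 - / 3) - p (/ 3)).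
  { apply (nonneg_of_derive_nonneg (fun u => ln (1 + u) - ln (1 - u) - p u)
      (fun u => 2 * u ^ 18 / (1 - u ^ 2))); [lra| | |].
    - intros t Ht. unfold p. auto_derive; [repeat split; lra|]. field. repeat split; nra.
    - intros t Ht. apply Rdiv_le_0_compat; [|nra].
      pose proof (pow_le t 18 ltac:(lra)). lra.
    - unfold p. rewrite Rplus_0_r, Rminus_0_r, ln_1. field. }
  (* The remainder has derivative 2 u^18 / (1 - u^2), and 9/4 is the maximum of 2/(1 - u^2) on
     [0, 1/3]. *)
  assert (HU : 0 <= 9 / 4 * ((/ 3) ^ 19 / 19) + p (/ 3) - (ln (1 + / 3) - ln (1 - / 3))).
  { apply (nonneg_of_derive_nonneg
      (fun u => 9 / 4 * (u ^ 19 / 19) + p u - (ln (1 + u) - ln (1 - u)))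
      (fun u => u ^ 18 * (9 / 4 - 2 / (1 - u ^ 2)))); [lra| | |].
    - intros t Ht. unfold p. auto_derive; [repeat split; lra|]. field. repeat split; nra.
    - intros t Ht. apply Rmult_le_pos; [apply pow_le; lra|].
      assert (H : 0 < 1 - t ^ 2) by nra.
      assert (2 / (1 - t ^ 2) <= 9 / 4); [|lra].
      apply (proj2 (Rle_div_l _ _ _ H)). nra.
    - unfold p. rewrite Rplus_0_r, Rminus_0_r, ln_1. field. }
  assert (Ep : p (/ 3) = 7616225505626 / 10987890768855) by (unfold p; field).
  assert (Eq : 9 / 4 * ((/ 3) ^ 19 / 19) = 1 / 9814652388) by field.
  rewrite Hln in HL, HU. rewrite Ep in HL, HU. rewrite Eq in HU. lra.
Qed.

Lemma ln_2_sub_gamma_bounds :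
  1159315 / 10 ^ 7 <= ln 2 - euler_gamma <= 11593155 / 10 ^ 8.
Proof.
  (* This is n = 32 = 2^5, so the only logarithm involved is 5 ln 2; the two bounds differ by 1/(120
     * 32^4), about 8 * 10^(-9). *)
  pose proof (euler_gamma_between 31) as [L U].
  pose proof ln_2_bounds as [L2 U2].
  unfold gamma_lower, gamma_upper in *.
  assert (E : ln (INR 32) = 5 * ln 2).
  { replace (INR 32) with (2 ^ 5) by (simpl; ring). rewrite ln_pow by lra. simpl; ring. }
  rewrite E in *.
  assert (EN : INR 32 = 32) by (simpl; ring). rewrite EN in *.
  assert (EH : harmonic 32 = 586061125622639 / 144403552893600).
  { cbn [harmonic]. rewrite !INR_IZR_INZ. simpl. field. }
  rewrite EH in *. lra.
Qed.

(** * Truncation of the series of order zero *)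

Lemma fact_add_ge (m n : nat) : INR (fact m) * INR (fact n) <= INR (fact (m + n)).
Proof.
  induction n as [|n IH].
  - rewrite Nat.add_0_r. simpl. lra.
  - rewrite Nat.add_succ_r, !INR_fact_S, plus_INR.
    pose proof (INR_fact_pos (m + n)). pose proof (pos_INR n). pose proof (pos_INR m).
    replace (INR (fact m) * ((INR n + 1) * INR (fact n)))
      with ((INR n + 1) * (INR (fact m) * INR (fact n))) by ring.
    apply Rle_trans with ((INR n + 1) * INR (fact (m + n))).
    + apply Rmult_le_compat_l; lra.
    + apply Rmult_le_compat_r; lra.
Qed.

Lemma inv_fact_add_sqr (m n : nat) :
  / (INR (fact (m + n)) * INR (fact (m + n))) <= / INR (fact m) ^ 2 * / INR (fact n).
Proof.
  pose proof (fact_add_ge m n) as H.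
  pose proof (INR_fact_pos m). pose proof (INR_fact_pos n).
  assert (1 <= INR (fact n)) by (apply (le_INR 1), lt_O_fact).
  assert (0 < INR (fact m) * INR (fact n)) by now apply Rmult_lt_0_compat.
  rewrite <- Rinv_mult. apply Rinv_le_contravar.
  - apply Rmult_lt_0_compat; [apply pow_lt|]; lra.
  - apply Rle_trans with ((INR (fact m) * INR (fact n)) * (INR (fact m) * INR (fact n))).
    + replace ((INR (fact m) * INR (fact n)) * (INR (fact m) * INR (fact n)))
        with (INR (fact m) ^ 2 * (INR (fact n) * INR (fact n))) by ring.
      apply Rmult_le_compat_l; [apply pow2_ge_0|]. nra.
    + apply Rmult_le_compat; lra.
Qed.

(** The tail is z^(N+1) times a series dominated by M exp (4 z). The range z <= 1/4, that is x <= 1,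
    makes the exponential at most e <= 3. *)
Lemma pseries_tail (a : nat -> R) (M z : R) (N : nat) : 0 <= z <= / 4 ->
  (forall n : nat, 0 <= a n) ->
  ex_pseries a z ->
  (forall n : nat, a (S N + n)%nat <= M * 4 ^ n / INR (fact n)) ->
  sum_f_R0 (fun k => a k * z ^ k) N <= PSeries a z
    <= sum_f_R0 (fun k => a k * z ^ k) N + z ^ S N * (3 * M).
Proof.
  intros Hz Ha Hex HM.
  assert (Hexs : ex_series (fun k => a k * z ^ k)) by now apply ex_pseries_R.
  unfold PSeries at 1 2. rewrite (Series_incr_n _ (S N)) by (lia || exact Hexs).
  simpl pred.
  assert (E : Series (fun k => a (S N + k)%nat * z ^ (S N + k))
              = z ^ S N * PSeries (fun k => a (S N + k)%nat) z).
  { unfold PSeries. rewrite <- Series_scal_l. apply Series_ext. intros k.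
    rewrite pow_add. ring. }
  rewrite E.
  assert (Habs : forall n : nat, Rabs (a (S N + n)%nat) <= M * 4 ^ n / INR (fact n)).
  { intros n. rewrite Rabs_right by (apply Rle_ge, Ha). apply HM. }
  destruct (pseries_exp_bound (fun k => a (S N + k)%nat) M z ltac:(lra) Habs) as [Hex' Hb].
  assert (HM0 : 0 <= M).
  { specialize (HM 0%nat). specialize (Ha (S N + 0)%nat). simpl in HM. simpl in Ha. lra. }
  assert (He : exp (4 * z) <= 3) by (eapply Rle_trans; [apply exp_le|exact exp_le_3]; lra).
  assert (Hp : 0 <= PSeries (fun k => a (S N + k)%nat) z).
  { unfold PSeries. apply Rle_trans with (Series (fun n => Rabs (a (S N + n)%nat * z ^ n))).
    - eapply Rle_trans; [apply Rabs_pos|apply Series_Rabs].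
      apply ex_series_ext with (fun n => a (S N + n)%nat * z ^ n).
      + intros n. rewrite Rabs_right; [reflexivity|]. apply Rle_ge, Rmult_le_pos;
          [apply Ha|apply pow_le; lra].
      + now apply ex_pseries_R.
    - right. apply Series_ext. intros n. apply Rabs_right, Rle_ge, Rmult_le_pos;
        [apply Ha|apply pow_le; lra]. }
  rewrite Rabs_right in Hb by lra.
  pose proof (pow_le z (S N) ltac:(lra)) as HzN.
  split.
  - assert (0 <= z ^ S N * PSeries (fun k => a (S N + k)%nat) z) by now apply Rmult_le_pos. lra.
  - apply Rplus_le_compat_l, Rmult_le_compat_l; [exact HzN|]. nra.
Qed.

Lemma bessel_I_0 (x : R) : 0 < x ->
  bessel_I 0 x = PSeries (rising_coef 0 0) ((x / 2) ^ 2).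
Proof.
  intros Hx. rewrite bessel_I_eq by exact Hx. rewrite Rpower_O by lra.
  pose proof (bessel_P_rising 0 0 ((x / 2) ^ 2) ltac:(lra)) as E.
  rewrite !Rplus_0_r in E. simpl INR in E. rewrite E, rGamma_1. unfold rising_series. ring.
Qed.

Lemma rising_coef_0_0 (n : nat) : rising_coef 0 0 n = / (INR (fact n) * INR (fact n)).
Proof. unfold rising_coef. rewrite Nat.add_0_r, inv_rising_0. unfold Rdiv. ring. Qed.

Lemma bessel_I_0_tail (N : nat) (x : R) : 0 < x <= 1 ->
  let s := sum_f_R0 (fun k => / (INR (fact k) * INR (fact k)) * ((x / 2) ^ 2) ^ k) N in
  s <= bessel_I 0 x <= s + ((x / 2) ^ 2) ^ S N * (3 * / INR (fact (S N)) ^ 2).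
Proof.
  intros Hx s. unfold s. rewrite bessel_I_0 by lra.
  rewrite (PSeries_ext _ _ _ rising_coef_0_0).
  apply pseries_tail.
  - nra.
  - intros n. pose proof (INR_fact_pos n). left. apply Rinv_0_lt_compat. nra.
  - apply (ex_pseries_ext (rising_coef 0 0)); [exact rising_coef_0_0|].
    apply ex_pseries_rising; [apply pow2_ge_0|rewrite Rabs_R0; lra].
  - intros n. eapply Rle_trans; [apply inv_fact_add_sqr|].
    pose proof (INR_fact_pos n) as Hf. pose proof (INR_fact_pos (S N)) as Hf2.
    apply Rmult_le_compat_r; [left; now apply Rinv_0_lt_compat|].
    assert (0 < / INR (fact (S N)) ^ 2) by (apply Rinv_0_lt_compat, pow_lt, Hf2).
    assert (1 <= 4 ^ n) by (apply pow_R1_Rle; lra). nra.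
Qed.

Lemma harmonic_series_tail (N : nat) (x : R) : 0 < x <= 1 ->
  let s := sum_f_R0 (fun k => harmonic_coef k * ((x / 2) ^ 2) ^ k) N in
  s <= harmonic_series ((x / 2) ^ 2)
    <= s + ((x / 2) ^ 2) ^ S N * (3 * (4 ^ S N * / INR (fact (S N)) ^ 2)).
Proof.
  intros Hx s. unfold s, harmonic_series.
  apply pseries_tail.
  - nra.
  - intros n. pose proof (INR_fact_pos n). apply Rdiv_le_0_compat; [|nra].
    apply harmonic_bounds.
  - apply ex_pseries_harmonic, pow2_ge_0.
  - intros n. unfold harmonic_coef, Rdiv.
    pose proof (harmonic_bounds (S N + n)) as Hh.
    apply Rle_trans with (4 ^ (S N + n) * (/ INR (fact (S N)) ^ 2 * / INR (fact n))).
    + apply Rmult_le_compat; [lra| |lra|apply inv_fact_add_sqr].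
      pose proof (INR_fact_pos (S N + n)). left. apply Rinv_0_lt_compat. nra.
    + rewrite pow_add. right. ring.
Qed.

(** The logarithm enters K_0 with coefficient -I_0, so adding ln x leaves - ln x (I_0^2 - 1). On (0,
    1] the last two terms are nonnegative, and the first exceeds ln 2 - gamma because I_0 > 1. *)
Lemma bessel_IK_0_eq (x : R) : 0 < x ->
  bessel_I 0 x * bessel_K 0 x + ln x
  = (ln 2 - euler_gamma) * bessel_I 0 x ^ 2 + bessel_I 0 x * harmonic_series ((x / 2) ^ 2)
    + - ln x * (bessel_I 0 x ^ 2 - 1).
Proof.
  intros Hx. rewrite bessel_K_0 by exact Hx. unfold bessel_K0.
  rewrite ln_div by lra. ring.
Qed.

Lemma bessel_I_0_gt_1 (x : R) : 0 < x <= 1 -> 1 < bessel_I 0 x.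
Proof.
  intros Hx. pose proof (bessel_I_0_tail 1 x Hx) as [L _]. simpl in L. nra.
Qed.

Lemma harmonic_series_nonneg (x : R) : 0 < x <= 1 -> 0 <= harmonic_series ((x / 2) ^ 2).
Proof.
  intros Hx. pose proof (harmonic_series_tail 0 x Hx) as [L _].
  cbv zeta in L. set (h := harmonic_series _) in *.
  unfold harmonic_coef in L. simpl in L. lra.
Qed.

Lemma bessel_IK_0_lower (x : R) : 0 < x <= 1 ->
  ln 2 - euler_gamma < bessel_I 0 x * bessel_K 0 x + ln x.
Proof.
  intros Hx. rewrite bessel_IK_0_eq by lra.
  pose proof ln_2_sub_gamma_bounds as [L _].
  pose proof (bessel_I_0_gt_1 x Hx) as HI.
  pose proof (harmonic_series_nonneg x Hx) as HH.
  assert (Hln : 0 <= - ln x) by (pose proof (ln_le_sub1 x); lra).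
  assert (H1 : 1 < bessel_I 0 x ^ 2) by nra.
  assert (0 <= bessel_I 0 x * harmonic_series ((x / 2) ^ 2)) by (apply Rmult_le_pos; lra).
  assert (0 <= - ln x * (bessel_I 0 x ^ 2 - 1)) by (apply Rmult_le_pos; lra).
  nra.
Qed.

(** Only the vanishing of the error at 0 matters, so 20 is generous. The logarithmic term is tamed
    by - ln x <= 1/x against I_0^2 - 1 <= 3 x^2. *)
Lemma bessel_IK_0_upper (x : R) : 0 < x <= 1 ->
  bessel_I 0 x * bessel_K 0 x + ln x <= ln 2 - euler_gamma + 20 * x.
Proof.
  intros Hx. rewrite bessel_IK_0_eq by lra.
  pose proof ln_2_sub_gamma_bounds as [L U].
  pose proof (bessel_I_0_gt_1 x Hx) as HI.
  pose proof (bessel_I_0_tail 0 x Hx) as [_ UI].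
  pose proof (harmonic_series_nonneg x Hx) as HH0.
  pose proof (harmonic_series_tail 0 x Hx) as [_ HH].
  cbv zeta in UI, HH.
  set (i := bessel_I 0 x) in *. set (h := harmonic_series ((x / 2) ^ 2)) in *.
  unfold harmonic_coef in HH. simpl in UI, HH.
  assert (Hi : i <= 1 + x ^ 2) by nra.
  assert (Hh : h <= 3 * x ^ 2) by nra. clear UI HH.
  assert (Hx2 : 0 < x ^ 2 <= x) by nra.
  assert (Hi2 : 0 <= i ^ 2 - 1 <= x ^ 2 * 3).
  { replace (i ^ 2 - 1) with ((i - 1) * (i + 1)) by ring.
    split; [apply Rmult_le_pos|apply Rmult_le_compat]; lra. }
  assert (Hinv : 0 < / x) by (apply Rinv_0_lt_compat; lra).
  assert (Hln : 0 <= - ln x <= / x).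
  { pose proof (ln_le_sub1 x ltac:(lra)). pose proof (ln_le_sub1 (/ x) Hinv) as H1.
    rewrite ln_Rinv in H1 by lra. lra. }
  assert (T3 : - ln x * (i ^ 2 - 1) <= 3 * x).
  { apply Rle_trans with (/ x * (x ^ 2 * 3)); [|right; field; lra].
    apply Rmult_le_compat; lra. }
  assert (T2 : i * h <= 2 * (3 * x ^ 2)) by (apply Rmult_le_compat; lra).
  assert (T1 : (ln 2 - euler_gamma) * (i ^ 2 - 1) <= 1 * (x ^ 2 * 3))
    by (apply Rmult_le_compat; lra).
  lra.
Qed.

Lemma bessel_IK_0_one_bounds :
  5330446 / 10 ^ 7 <= bessel_I 0 1 * bessel_K 0 1 <= 5330449 / 10 ^ 7.
Proof.
  pose proof (bessel_IK_0_eq 1 Rlt_0_1) as E. rewrite ln_1, Ropp_0, Rmult_0_l, !Rplus_0_r in E.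
  rewrite E.
  pose proof ln_2_sub_gamma_bounds as [L U].
  assert (F0 : INR (fact 0) = 1) by reflexivity.
  assert (F1 : INR (fact 1) = 1)
    by (rewrite INR_fact_S, F0; simpl; ring).
  assert (F2 : INR (fact 2) = 2)
    by (rewrite INR_fact_S, F1; simpl; ring).
  assert (F3 : INR (fact 3) = 6)
    by (rewrite INR_fact_S, F2; simpl; ring).
  assert (F4 : INR (fact 4) = 24)
    by (rewrite INR_fact_S, F3; simpl; ring).
  assert (F5 : INR (fact 5) = 120)
    by (rewrite INR_fact_S, F4; simpl; ring).
  assert (F6 : INR (fact 6) = 720)
    by (rewrite INR_fact_S, F5; simpl; ring).
  assert (F7 : INR (fact 7) = 5040)
    by (rewrite INR_fact_S, F6; simpl; ring).
  assert (F8 : INR (fact 8) = 40320)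
    by (rewrite INR_fact_S, F7; simpl; ring).
  assert (H0 : harmonic 0 = 0) by reflexivity.
  assert (H1 : harmonic 1 = 1 / 1)
    by (rewrite harmonic_S, H0; simpl; field).
  assert (H2 : harmonic 2 = 3 / 2)
    by (rewrite harmonic_S, H1; simpl; field).
  assert (H3 : harmonic 3 = 11 / 6)
    by (rewrite harmonic_S, H2; simpl; field).
  assert (H4 : harmonic 4 = 25 / 12)
    by (rewrite harmonic_S, H3; simpl; field).
  assert (H5 : harmonic 5 = 137 / 60)
    by (rewrite harmonic_S, H4; simpl; field).
  assert (H6 : harmonic 6 = 49 / 20)
    by (rewrite harmonic_S, H5; simpl; field).
  assert (H7 : harmonic 7 = 363 / 140)
    by (rewrite harmonic_S, H6; simpl; field).
  assert (Bi : 12660658 / 10 ^ 7 <= bessel_I 0 1 <= 12660659 / 10 ^ 7).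
  { pose proof (bessel_I_0_tail 7 1 ltac:(lra)) as B.
    cbv zeta in B. cbn [sum_f_R0] in B.
    rewrite F0, F1, F2, F3, F4, F5, F6, F7, F8 in B. lra. }
  assert (Bh : 27424750 / 10 ^ 8 <= harmonic_series ((1 / 2) ^ 2) <= 27424751 / 10 ^ 8).
  { pose proof (harmonic_series_tail 7 1 ltac:(lra)) as B.
    cbv zeta in B. unfold harmonic_coef in B. cbn [sum_f_R0] in B.
    rewrite H0, H1, H2, H3, H4, H5, H6, H7 in B.
    rewrite F0, F1, F2, F3, F4, F5, F6, F7, F8 in B. lra. }
  set (i := bessel_I 0 1) in *. set (h := harmonic_series ((1 / 2) ^ 2)) in *.
  set (l := ln 2 - euler_gamma) in *. clearbody i h l.
  (* All quantities are positive, so in this nested form the enclosures of l, i and h multiply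
     endpoint by endpoint. *)
  replace (l * i ^ 2 + i * h) with (i * (l * i + h)) by ring.
  assert (B1 : 1159315 / 10 ^ 7 * (12660658 / 10 ^ 7) <= l * i <= 11593155 / 10 ^ 8 * (12660659 / 10 ^ 7))
    by (split; apply Rmult_le_compat; lra).
  assert (B2 : 12660658 / 10 ^ 7 * (1159315 / 10 ^ 7 * (12660658 / 10 ^ 7) + 27424750 / 10 ^ 8)
     <= i * (l * i + h)
     <= 12660659 / 10 ^ 7 * (11593155 / 10 ^ 8 * (12660659 / 10 ^ 7) + 27424751 / 10 ^ 8))
    by (split; apply Rmult_le_compat; lra).
  lra.
Qed.

Theorem theorem3 :
  (forall nu : R, 0 <= nu ->
     forall x y : R, 0 < x -> x < y ->
       bessel_I nu x * bessel_K nu x + ln x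
         < bessel_I nu y * bessel_K nu y + ln y)
  /\
  (forall nu x : R, 0 <= nu -> 0 < x <= 1 ->
     bessel_I nu x * bessel_K nu x + ln x <= bessel_I nu 1 * bessel_K nu 1)
  /\
  (forall x : R, 0 < x <= 1 ->
     ln 2 - euler_gamma < bessel_I 0 x * bessel_K 0 x + ln x
     /\ bessel_I 0 x * bessel_K 0 x + ln x <= bessel_I 0 1 * bessel_K 0 1)
  /\
  (forall c : R,
     (forall x : R, 0 < x <= 1 ->
        c <= bessel_I 0 x * bessel_K 0 x + ln x) ->
     c <= ln 2 - euler_gamma)
  /\
  (forall c : R,
     (forall x : R, 0 < x <= 1 ->
        bessel_I 0 x * bessel_K 0 x + ln x <= c) ->
     bessel_I 0 1 * bessel_K 0 1 <= c)
  /\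
  Rabs (bessel_I 0 1 * bessel_K 0 1 - 533045 / 1000000) <= 5 / 10000000.
Proof.
  assert (Hle1 : forall nu x : R, 0 <= nu -> 0 < x <= 1 ->
    bessel_I nu x * bessel_K nu x + ln x <= bessel_I nu 1 * bessel_K nu 1).
  { intros nu x Hnu [Hx [Hx1 | ->]]; [|rewrite ln_1; lra].
    pose proof (bessel_IK_ln_lt nu x 1 Hnu Hx Hx1) as H. rewrite ln_1 in H. lra. }
  repeat split.
  - intros nu Hnu x y. now apply bessel_IK_ln_lt.
  - exact Hle1.
  - now apply bessel_IK_0_lower.
  - apply Hle1; [lra|assumption].
  - intros c Hc. apply Rnot_lt_le. intros Hlt.
    set (d := c - (ln 2 - euler_gamma)).
    assert (Hd : 0 < d) by (unfold d; lra).
    (* Then 20 x <= d/2, so the upper bound at x stays below c. *)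
    set (x := Rmin 1 (d / 40)).
    assert (Hx : 0 < x <= 1).
    { split; [apply Rmin_pos; lra|apply Rmin_l]. }
    pose proof (Rmin_r 1 (d / 40) : x <= d / 40).
    pose proof (Hc x Hx). pose proof (bessel_IK_0_upper x Hx). unfold d in *. lra.
  (* The upper constant is attained at x = 1. *)
  - intros c Hc. specialize (Hc 1 ltac:(lra)). rewrite ln_1 in Hc. lra.
  (* The tolerance is half a unit of the sixth decimal: the value, just below 0.533045, rounds to
     it. *)
  - apply Rabs_le. pose proof bessel_IK_0_one_bounds. lra.
Qed.
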